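(* Let $C_1$ be the graph of the $3$-dimensional cube. Then $C_1$ is the only C3CBP on $8$ or fewer vertices (up to isomorphism), and repeatedly applying the reductions $R_0$ and $R_4$ to any other C3CBP, in such a way that each graph obtained is a C3CBP, eventually leads to $C_1$. Consequently every C3CBP can be generated from $C_1$ by applying the reverses of the reductions $R_0$ and $R_4$.
   Context: A C3CBP (also called a Barnette graph) is a cubic, $3$-connected, bipartite, planar graph. A graph is $3$-connected if it has more than $3$ vertices and deleting any set of fewer than $3$ vertices leaves a connected graph. Reduction $R_0$: let $a_1a_2a_3a_4$ be a face of length $4$ (with $a_i$ adjacent to $a_{i+1}$, indices modulo $4$) and let $b_i$ be the third neighbour of $a_i$, outside the face. Delete $a_1,a_2,a_3,a_4$ and add either the two edges $b_1b_2$ and $b_3b_4$, or the two edges $b_2b_3$ and $b_4b_1$. Reduction $R_4$: let $j,h_1,h_2,h_3,x_1,x_2,x_3$ be seven vertices inducing a subgraph (a cube minus one vertex) whose edges are $jh_1,jh_2,jh_3$ and $x_1h_1,x_1h_2,x_2h_1,x_2h_3,x_3h_2,x_3h_3$, and let $y_i$ be the neighbour of $x_i$ outside this set. Delete the seven vertices and add one new vertex adjacent to $y_1,y_2,y_3$. *)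

(* Defs.v *)
From HB Require Import structures.
From mathcomp Require Import all_boot all_fingroup.

Set Implicit Arguments.
Unset Strict Implicit.
Unset Printing Implicit Defensive.

Record sgraph := SGraph {
  vertex :> finType;
  adj : rel vertex;
  adj_sym : symmetric adj;
  adj_irr : irreflexive adj }.

Definition giso (G H : sgraph) : Prop :=
  exists2 f : G -> H, bijective f & forall x y : G, adj (f x) (f y) = adj x y.

Section Operations.
Variable G : sgraph.

Section DeleteVertices.
Variable S : {set G}.

Definition del_adj : rel {x : G | x \notin S} :=
  fun u v => adj (val u) (val v).

Lemma del_adj_sym : symmetric del_adj.
Proof. by move=> u v; apply: adj_sym. Qed.

Lemma del_adj_irr : irreflexive del_adj.
Proof. by move=> u; apply: adj_irr. Qed.

Definition del_vertices : sgraph := SGraph del_adj_sym del_adj_irr.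
End DeleteVertices.

Section AddEdge.
Variables u v : G.

(* No loop is added when u = v, and no parallel edge when u and v are already
   adjacent. *)
Definition add_edge_adj : rel G :=
  fun x y => adj x y ||
    (u != v) && ((x == u) && (y == v) || (x == v) && (y == u)).

Lemma add_edge_sym : symmetric add_edge_adj.
Proof.
move=> x y; rewrite /add_edge_adj adj_sym.
by rewrite [(y == u) && _]andbC [(y == v) && _]andbC [X in _ && X]orbC.
Qed.

Lemma add_edge_irr : irreflexive add_edge_adj.
Proof.
move=> x; rewrite /add_edge_adj adj_irr /= [(x == v) && _]andbC orbb.
by case: (eqVneq x u) => [-> | _]; rewrite ?andbF //= andNb.
Qed.

Definition add_edge : sgraph := SGraph add_edge_sym add_edge_irr.
End AddEdge.

Section AddVertex.
Variable N : {set G}.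

(* None is the new vertex, with neighbourhood N. *)
Definition add_vertex_adj : rel (option G) :=
  fun u v => match u, v with
             | Some x, Some y => adj x y
             | None, Some x | Some x, None => x \in N
             | None, None => false
             end.

Lemma add_vertex_sym : symmetric add_vertex_adj.
Proof. by case=> [x|] [y|] //=; rewrite adj_sym. Qed.

Lemma add_vertex_irr : irreflexive add_vertex_adj.
Proof. by case=> [x|] //=; apply: adj_irr. Qed.

Definition add_vertex : sgraph := SGraph add_vertex_sym add_vertex_irr.
End AddVertex.

End Operations.

Section Planarity.
Variable G : sgraph.

Definition dart : finType := {d : G * G | adj d.1 d.2}.

Definition source (d : dart) : G := (val d).1.

Lemma flip_subproof (d : dart) : adj (val d).2 (val d).1.
Proof. by rewrite adj_sym; apply: (valP d). Qed.

Definition flip_fun (d : dart) : dart :=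
  Sub ((val d).2, (val d).1) (flip_subproof d).

Lemma flip_fun_inj : injective flip_fun.
Proof. by apply: inv_inj => d; apply/val_inj; case: d => -[]. Qed.

Definition flip : {perm dart} := perm flip_fun_inj.

(* The darts leaving each vertex are cyclically ordered by s. *)
Definition rotation_system (s : {perm dart}) : Prop :=
  forall d d' : dart, (d' \in porbit s d) = (source d' == source d).

(* Products of permutations are read from left to right: the dart following
   (x, y) on its face is the successor of (y, x) around y. *)
Definition face_perm (s : {perm dart}) : {perm dart} := (flip * s)%g.

(* An isolated vertex carries no dart, but its component, drawn alone on a
   sphere, has one face. *)
Definition n_faces (s : {perm dart}) : nat :=
  #|porbits (face_perm s)| + #|[set x : G | [forall y, ~~ adj x y]]|.

(* Embeddings in the sphere, given combinatorially: each component with its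
   rotation system satisfies Euler's formula V - E + F = 2. As V - E + F is at
   most 2 on every component, it is enough to add up over the components. *)
Definition plane_embedding (s : {perm dart}) : Prop :=
  rotation_system s /\
  #|G| + n_faces s = #|porbits flip| + 2 * n_comp (@adj G) [pred x : G | true].

Definition planar : Prop := exists s : {perm dart}, plane_embedding s.

(* The vertices met along some face of s are, in cyclic order, those of c. *)
Definition is_face (s : {perm dart}) (c : seq G) : Prop :=
  exists d : dart, [seq source d' | d' <- fingraph.orbit (face_perm s) d] = c.

End Planarity.

Definition cubic (G : sgraph) : Prop :=
  forall x : G, #|[set y | adj x y]| = 3.

Definition connected (G : sgraph) : Prop :=
  forall x y : G, connect (@adj G) x y.

Definition three_connected (G : sgraph) : Prop :=
  3 < #|G| /\ forall S : {set G}, #|S| < 3 -> connected (del_vertices S).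

Definition bipartite (G : sgraph) : Prop :=
  exists c : G -> bool, forall x y : G, adj x y -> c x != c y.

Definition C3CBP (G : sgraph) : Prop :=
  [/\ cubic G, three_connected G, bipartite G & planar G].

Definition cube_adj : rel (bool * bool * bool) :=
  fun u v => (u.1.1 != v.1.1) + (u.1.2 != v.1.2) + (u.2 != v.2) == 1.

Lemma cube_adj_sym : symmetric cube_adj.
Proof. by do 2![case=> [[[] []] []]]. Qed.

Lemma cube_adj_irr : irreflexive cube_adj.
Proof. by case=> [[[] []] []]. Qed.

Definition cube : sgraph := SGraph cube_adj_sym cube_adj_irr.

Definition R0 (G H : sgraph) : Prop :=
  exists a1 a2 a3 a4 : G,
  let A := [set a1; a2; a3; a4] in
  let D := del_vertices A in
  exists b1 b2 b3 b4 : D,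
  [/\ uniq [:: a1; a2; a3; a4],
      exists2 s, plane_embedding s & is_face s [:: a1; a2; a3; a4],
      [/\ adj a1 (val b1), adj a2 (val b2), adj a3 (val b3)
        & adj a4 (val b4)]
    & giso (@add_edge (add_edge b1 b2) b3 b4) H \/
      giso (@add_edge (add_edge b2 b3) b4 b1) H].

(* The edges of the cube minus one vertex, with the seven vertices numbered
   j, h1, h2, h3, x1, x2, x3 from 0 to 6. *)
Definition cube_minus_vertex_edges : seq (nat * nat) :=
  [:: (0, 1); (0, 2); (0, 3);
      (4, 1); (4, 2); (5, 1); (5, 3); (6, 2); (6, 3)].

Definition R4 (G H : sgraph) : Prop :=
  exists j h1 h2 h3 x1 x2 x3 : G,
  let s := [:: j; h1; h2; h3; x1; x2; x3] in
  let D := del_vertices [set z in s] in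
  exists y1 y2 y3 : D,
  [/\ uniq s,
      forall m n, m < 7 -> n < 7 ->
        adj (nth j s m) (nth j s n) =
        ((m, n) \in cube_minus_vertex_edges) ||
        ((n, m) \in cube_minus_vertex_edges),
      [/\ adj x1 (val y1), adj x2 (val y2) & adj x3 (val y3)]
    & giso (add_vertex [set y1; y2; y3]) H].

Definition reduces (G H : sgraph) : Prop :=
  [/\ C3CBP G, C3CBP H & R0 G H \/ R4 G H].

(* Whatever reductions are chosen, one never gets stuck, and reaches the cube
   after finitely many of them. *)
Inductive leads_to_cube (G : sgraph) : Prop :=
| leads_now : giso G cube -> leads_to_cube G
| leads_step : (exists H, reduces G H) ->
    (forall H, reduces G H -> leads_to_cube H) -> leads_to_cube G.

Inductive generated_from_cube : sgraph -> Prop :=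
| generated_cube (G : sgraph) : giso cube G -> generated_from_cube G
| generated_step (H G : sgraph) :
    generated_from_cube H -> reduces G H -> generated_from_cube G.

(* Main.v *)
Require Import Defs.
From HB Require Import structures.
From mathcomp Require Import all_boot all_fingroup.
From mathcomp Require Import zify.

Set Implicit Arguments.
Unset Strict Implicit.
Unset Printing Implicit Defensive.

(* For a cubic graph, 3-connectedness means that every nontrivial edge cut has at
   least 3 edges.  By Euler's formula a C3CBP has a face of length 4, and so does
   each side with more than one vertex of a 3-edge-cut, with all four vertices on
   that side: the genus inequality bounds the number of faces on the other side.
   Let a1 a2 a3 a4 be such a face, chosen inside a minimal nontrivial side X of a
   3-edge-cut if there is one.  If neither reduction R0 at this face keeps the
   graph 3-connected, there are two 4-edge-cuts that cross the face, one
   separating {a1, a2} from {a3, a4}, the other {a2, a3} from {a4, a1}.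
   Uncrossing them splits the other vertices into Q1, ..., Q4 such that
   contracting each Qi yields the cube, each Qi being a side of a 3-edge-cut.
   The complement of X lies in a single Qi, so by minimality the other three are
   single vertices.  Either the fourth is one too and the graph is the cube, or
   R4 applies, and it amounts to contracting the complement of the fourth.
   Both reductions lower the number of vertices.

   Planarity of the reduced graph H only requires that H has enough faces, since
   by the genus inequality it cannot have too many: the darts of H are mapped to
   darts of G so that faces of H are sent into faces of G (for R0, after
   composing with one transposition), and the missed faces are counted. *)
(** * Cycles of permutations and the genus inequality *)

(** Planarity is handled only through inequalities between numbers of orbits: an invariant with many
    values bounds them from below, the genus inequality from above. The latter is also applied to
    truncated maps (an edge cut open, one side of a cut with dangling half-edges), whose components
    depend on the truncation. So components are not counted: a set [R] of darts has to meet every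
    nonempty stable set, and 3-edge-connectedness shows how small [R] can be. As [2E = 3V] in a
    cubic graph, Euler's formula takes the form [2F = V + 4]. Connectivity is handled by counting
    edges across cuts, so that uncrossing becomes linear arithmetic on six numbers. Cuts are defined
    for weighted graphs because R0 could a priori create loops or parallel edges, which simple
    graphs silently discard; once all nontrivial cuts have at least 3 edges, the weights are at most
    1. The extremal [X] is there because failure of R0 alone leaves the sizes of the [Qi] free,
    while R4 needs three of them to be single vertices. *)

Section PermOrbits.
Variable T : finType.
Implicit Types (p e n : {perm T}) (S R : {set T}).

Lemma porbit_invariant (U : Type) p (g : T -> U) :
  (forall x, g (p x) = g x) -> forall x y, y \in porbit p x -> g y = g x.
Proof.
move=> gp x y /porbitP[i ->]; elim: i => [|i IHi]; first by rewrite expg0 perm1.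
by rewrite expgSr permM gp.
Qed.

(** Lower bounds on numbers of faces come from here: exhibit an invariant of the face permutation
    and count its values. *)
Lemma card_invariant_porbits (U : finType) p (g : T -> U) :
  (forall x, g (p x) = g x) -> #|g @: setT| <= #|porbits p|.
Proof.
move=> gp; have [x0 _|T0] := pickP (mem T); last first.
  by rewrite (_ : g @: setT = set0) ?cards0 //; apply/setP=> u; rewrite !inE;
     apply/imsetP=> -[x]; have := T0 x.
pose h (O : {set T}) := g (odflt x0 [pick x in O]).
apply: leq_trans (leq_imset_card h _); apply/subset_leq_card/subsetP=> u.
case/imsetP=> x _ ->; apply/imsetP; exists (porbit p x); first exact: imset_f.
rewrite /h; case: pickP => [y|/(_ x)] /=; last by rewrite porbit_id.
by move/(porbit_invariant gp).
Qed.

Lemma porbit_stable p S : (forall x, x \in S -> p x \in S) ->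
  forall x, x \in S -> porbit p x \subset S.
Proof.
move=> pS x xS; apply/subsetP=> y /porbitP[i ->].
by elim: i => [|i IHi]; rewrite ?expg0 ?perm1 // expgSr permM pS.
Qed.

Lemma porbit_step p x y : (p y \in porbit p x) = (y \in porbit p x).
Proof. by rewrite -!eq_porbit_mem -[p y]/((p ^+ 1)%g y) porbit_perm. Qed.

Lemma sum_porbits p (E : T -> nat) :
  \sum_(O in porbits p) \sum_(x in O) E x = \sum_x E x.
Proof.
have ptn : partition (porbits p) [set: T].
  apply/and3P; split.
  - apply/eqP/setP=> x; rewrite inE; apply/bigcupP.
    by exists (porbit p x); rewrite ?porbit_id ?imset_f.
  - apply/trivIsetP=> _ _ /imsetP[x _ ->] /imsetP[y _ ->].
    apply: contraR => /pred0Pn[z /andP[/= zx zy]].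
    by move: zx zy; rewrite -!eq_porbit_mem => /eqP-> /eqP->.
  - by apply/imsetP=> -[x _ /setP/(_ x)]; rewrite inE porbit_id.
by rewrite -(set_partition_big _ ptn); apply: eq_bigl => x; rewrite inE.
Qed.

Lemma porbits_involution p : involutive p ->
  2 * #|porbits p| = #|T| + #|[set x | p x == x]|.
Proof.
move=> pK.
have orb2 x : porbit p x = [set x; p x].
  apply/eqP; rewrite eqEsubset !subUset !sub1set porbit_step porbit_id !andbT.
  by apply: porbit_stable (set21 _ _) => y /set2P[]->; rewrite ?pK !inE eqxx ?orbT.
(* A fixed point weighs 2 and any other point 1, so every orbit weighs 2. *)
have -> : #|T| + #|[set x | p x == x]| = \sum_x (1 + (p x == x)).
  rewrite big_split sum1_card /= -sum1dep_card [X in _ + X = _]big_mkcond.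
  by congr (_ + _); apply: eq_bigr => x _; case: (_ == _).
rewrite -(sum_porbits p) mulnC -sum_nat_const; apply: eq_bigr => _ /imsetP[x _ ->].
rewrite orb2; have [px|px] := eqVneq (p x) x.
  by rewrite px setUid big_set1 px eqxx.
by rewrite big_setU1 ?inE 1?eq_sym // big_set1 pK (eq_sym x) (negPf px).
Qed.

(* Ree's form of the genus inequality, by splitting the cycles of [e] one
   transposition at a time: a split increases the number of cycles of [e] by
   one, and either merges two cycles of [e * n] and leaves the components
   unchanged, or splits a cycle of [e * n] and at most one component. *)
Lemma euler_inequality e n R :
  (forall S, S != set0 -> {in S, forall x, e x \in S} ->
     {in S, forall x, n x \in S} -> S :&: R != set0) ->
  #|porbits e| + #|porbits n| + #|porbits (e * n)%g| <= #|T| + 2 * #|R|.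
Proof.
have [m] := ubnP #|[set x | e x != x]|; elim: m e R => // m IHm e R le_m hR.
(* Base case [e = 1]: [e * n] is [n], so the orbits of [n] are counted twice, and [R] meets each of
   them. *)
have [x ex|e1] := pickP (fun x => e x != x); last first.
  have {}e1 : e = 1%g by apply/permP=> x; rewrite perm1; apply/eqP/negbFE/e1.
  have leR : #|porbits n| <= #|R|.
    apply: leq_trans (leq_imset_card (porbit n) R); apply/subset_leq_card/subsetP.
    move=> _ /imsetP[x _ ->].
    have /set0Pn[y /setIP[yx yR]] : porbit n x :&: R != set0.
      apply: hR => [|y|y]; last by rewrite porbit_step.
        by apply/set0Pn; exists x; apply: porbit_id.
      by rewrite e1 perm1.
    by apply/imsetP; exists y => //; apply/eqP; rewrite eq_sym eq_porbit_mem.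
  have leT : #|porbits e| <= #|T| by apply: leq_imset_card.
  rewrite e1 mul1g -e1; lia.
(* [e'] fixes [y] and sends [x] directly to [e y], so fewer points are moved. *)
pose y := e x; pose t := tperm x y; pose e' := (t * e)%g.
have e'y : e' y = y by rewrite permM tpermR.
have xy : x != y by rewrite eq_sym.
have e'E z : z != x -> z != y -> e' z = e z.
  by move=> zx zy; rewrite permM tpermD // eq_sym.
have e'x : e' x = e y by rewrite permM tpermL.
have lt_m : #|[set z | e' z != z]| < m.
  rewrite -ltnS (leq_trans _ le_m) // ltnS; apply: proper_card; apply/properP; split.
    apply/subsetP=> z; rewrite !inE.
    have [->|zy] := eqVneq z y; first by rewrite e'y eqxx.
    have [->|zx] := eqVneq z x; first by rewrite ex.
    by rewrite e'E.
  by exists y; rewrite !inE ?e'y ?eqxx // (inj_eq perm_inj).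
have Ze : #|porbits e'| = #|porbits e|.+1.
  have := porbits_mul_tperm e x y; rewrite -/t -/e' xy.
  rewrite porbit_sym (_ : y \in porbit e x); last by rewrite /y porbit_step porbit_id.
  by rewrite addn1 -/t -/e' => <-; rewrite addn0.
have stable_e S : {in S, forall z, e' z \in S} -> (x \in S) = (y \in S) ->
    {in S, forall z, e z \in S}.
  move=> Se' Sxy z zS; have [zx|zx] := eqVneq z x; first by rewrite zx -Sxy -zx.
  have [zy|zy] := eqVneq z y; first by rewrite zy -e'x Se' ?Sxy -?zy.
  by rewrite -e'E ?Se'.
have Zf : #|porbits (e' * n)%g| + (x \notin porbit (e * n)%g y).*2 =
    #|porbits (e * n)%g| + 1.
  by have := porbits_mul_tperm (e * n)%g x y; rewrite xy -mulgA.
case xyf: (x \in porbit (e * n)%g y) in Zf.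
  (* The split may create one component that misses [R]. If a stable set through [x] misses [y] and
     [R], mark [x]: a second stable set missing the marks would contain [y], and the union of the
     two would contradict [hR]. Otherwise marking [y] is enough. *)
  have [r hr] : exists r, forall S, S != set0 -> {in S, forall z, e' z \in S} ->
     {in S, forall z, n z \in S} -> S :&: (r |: R) != set0.
    have [/existsP[S /and5P[xS yS /eqP SR Se Sn]]|nox] := boolP [exists S : {set T},
        [&& x \in S, y \notin S, S :&: R == set0, [forall z in S, e' z \in S]
          & [forall z in S, n z \in S]]].
    - exists x => S' S'0 S'e S'n; apply/negP=> /eqP S'R0.
      have xS' : x \notin S'.
        by apply/negP=> xS'; have /setP/(_ x) := S'R0; rewrite !inE xS' eqxx.
      have S'R : S' :&: R = set0.
        by apply/eqP; rewrite -subset0 -S'R0 setIS // subsetUr.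
      have yS' : y \in S'.
        apply: contraT => yS'; have := hR S' S'0 _ S'n; rewrite S'R eqxx.
        by apply; apply: stable_e => //; rewrite (negPf yS') (negPf xS').
      have : (S :|: S') :&: R != set0; last by rewrite setIUl SR S'R setU0 eqxx.
      apply: hR.
      - by apply/set0Pn; exists x; rewrite inE xS.
      - apply: stable_e; last by rewrite !inE xS yS' orbT.
        move=> z; rewrite !inE => /orP[zS|/S'e->]; last by rewrite orbT.
        by rewrite (forall_inP Se).
      - move=> z; rewrite !inE => /orP[zS|/S'n->]; last by rewrite orbT.
        by rewrite (forall_inP Sn).
    - exists y => S S0 Se Sn; apply/negP=> /eqP SR0.
      have yS : y \notin S.
        by apply/negP=> yS; have /setP/(_ y) := SR0; rewrite !inE yS eqxx.
      have SR : S :&: R = set0.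
        by apply/eqP; rewrite -subset0 -SR0 setIS // subsetUr.
      have [xS|xS] := boolP (x \in S).
        case/existsP: nox; exists S; rewrite xS yS SR eqxx /=.
        by apply/andP; split; apply/forall_inP.
      suff : false by []; have := hR S S0 _ Sn; rewrite SR eqxx; apply.
      by apply: stable_e => //; rewrite (negPf xS) (negPf yS).
  have := IHm e' (r |: R) lt_m hr.
  have := cardsU1 r R; have := leq_b1 (r \notin R); lia.
(* Here [x] and [y] share a cycle of [e' * n], so a set stable under [e'] and [n] contains both or
   neither, and is therefore stable under [e]. *)
suff hR' : forall S, S != set0 -> {in S, forall z, e' z \in S} ->
     {in S, forall z, n z \in S} -> S :&: R != set0.
  have := IHm e' R lt_m hR'; lia.
move=> S S0 Se Sn; apply: hR => //; apply: stable_e => //.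
have Sf : {in S, forall z, (e' * n)%g z \in S} by move=> z zS; rewrite permM Sn ?Se.
have yf : y \in porbit (e' * n)%g x.
  have /= := porbits_mul_tperm (e' * n)%g x y; rewrite xy !mulgA tperm2 mul1g porbit_sym.
  have aux (a b : nat) : b + 1.*2 = a + 1 -> a + 1.*2 = b + 1 -> false by lia.
  by case: (_ \in porbit _ x) => //; apply: (aux _ _ Zf).
have xf : x \in porbit (e' * n)%g y by rewrite porbit_sym.
by apply/idP/idP=> zS; [apply: (subsetP (porbit_stable Sf zS)) yf
                       | apply: (subsetP (porbit_stable Sf zS)) xf].
Qed.
End PermOrbits.

(** Reduced graphs get their rotation this way: their darts embed into those of [G], and the
    rotation is read there. *)
Lemma perm_pullback (T U : finType) (i : T -> U) (p : {perm U}) : injective i ->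
  (forall x, exists y, i y = p (i x)) -> exists q : {perm T}, forall x, i (q x) = p (i x).
Proof.
move=> i_inj /fin_all_exists[q iq]; have q_inj : injective q.
  by move=> x y qxy; apply/i_inj/(@perm_inj _ p); rewrite -!iq qxy.
by exists (perm q_inj) => x; rewrite permE iq.
Qed.

(** * Edge cuts of weighted graphs *)

Section Cuts.
Variables (T : finType) (w : T -> T -> nat).
Hypothesis w_sym : forall x y, w x y = w y x.
Implicit Types (X Y Z : {set T}).

(** Ordered pairs are counted, so [edges X X] counts each inner edge twice; hence the degree sum
    [edges X X + cut X]. *)
Definition edges X Y := \sum_(x in X) \sum_(y in Y) w x y.
Definition cut X := edges X (~: X).

Lemma edgesC X Y : edges X Y = edges Y X.
Proof.
by rewrite /edges exchange_big /=; do 2![apply: eq_bigr => ? _]; apply: w_sym.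
Qed.

Lemma edgesID Y X Z : edges X Z = edges (X :&: Y) Z + edges (X :\: Y) Z.
Proof. exact: big_setID. Qed.

Lemma edgesU X Y Z : [disjoint X & Y] ->
  edges (X :|: Y) Z = edges X Z + edges Y Z.
Proof.
move=> dXY; rewrite (edgesID X) setUK; congr (_ + edges _ _).
by rewrite setDUl setDv set0U; apply/setDidPl; rewrite disjoint_sym.
Qed.

Lemma edgesU1 x X Z : x \notin X -> edges (x |: X) Z = edges [set x] Z + edges X Z.
Proof. by move=> xX; rewrite edgesU // disjoints1. Qed.

Lemma edges1 x Z : edges [set x] Z = \sum_(y in Z) w x y.
Proof. by rewrite /edges big_set1. Qed.

Lemma edges0 Z : edges set0 Z = 0.
Proof. by rewrite /edges big_set0. Qed.

Lemma leq_edges X X' Y Y' : X \subset X' -> Y \subset Y' -> edges X Y <= edges X' Y'.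
Proof.
move=> sX sY; rewrite (edgesID X X') (setIidPr sX) (edgesC X Y').
rewrite (edgesID Y Y') (setIidPr sY) (edgesC Y X); lia.
Qed.

Lemma cutC X : cut (~: X) = cut X.
Proof. by rewrite /cut setCK edgesC. Qed.

Lemma edges_setT X : edges X setT = edges X X + cut X.
Proof. by rewrite edgesC (edgesID X) setTI setTD !(edgesC _ X). Qed.

(** Submodularity with its defect made explicit: in terms of the six counts between corners, every
    uncrossing argument is left to [lia]. *)
Lemma cut_corners X Y :
  let P1 := X :\: Y in let P2 := X :&: Y in
  let P3 := Y :\: X in let P4 := ~: (X :|: Y) in
  [/\ cut X = edges P1 P3 + edges P1 P4 + edges P2 P3 + edges P2 P4,
      cut Y = edges P1 P2 + edges P1 P3 + edges P2 P4 + edges P3 P4,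
      cut P1 = edges P1 P2 + edges P1 P3 + edges P1 P4,
      cut P2 = edges P1 P2 + edges P2 P3 + edges P2 P4
    & cut P3 = edges P1 P3 + edges P2 P3 + edges P3 P4 /\
      cut P4 = edges P1 P4 + edges P2 P4 + edges P3 P4].
Proof.
set P1 := X :\: Y; set P2 := X :&: Y; set P3 := Y :\: X; set P4 := ~: _.
move=> /=; have split4 Z : edges Z setT =
    edges Z P1 + edges Z P2 + edges Z P3 + edges Z P4.
  rewrite edgesC (edgesID X) setTI setTD (edgesID Y) (edgesID Y (~: X)).
  rewrite -/P1 -/P2 -!(edgesC Z) [~: X :&: Y]setIC -setDE -/P3.
  by rewrite setDE -setCU -/P4; lia.
have eX Z : edges X Z = edges P1 Z + edges P2 Z by rewrite (edgesID Y) addnC.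
have eY Z : edges Y Z = edges P2 Z + edges P3 Z by rewrite (edgesID X) setIC.
have := edges_setT X; have := edges_setT Y; have := edges_setT P1.
have := edges_setT P2; have := edges_setT P3; have := edges_setT P4.
rewrite !split4 !(eX, eY) !(edgesC _ X, edgesC _ Y) !(eX, eY).
have := edgesC P1 P2; have := edgesC P1 P3; have := edgesC P1 P4.
have := edgesC P2 P3; have := edgesC P2 P4; have := edgesC P3 P4.
by split; [..| split]; lia.
Qed.

Definition edge_connected3 :=
  forall X, X != set0 -> X != setT -> 3 <= cut X.

Definition regular3 := forall x, \sum_y w x y = 3.

Hypothesis w3 : regular3.

Lemma edges_regular X : edges X setT = 3 * #|X|.
Proof.
rewrite /edges mulnC -sum_nat_const; apply: eq_bigr => x _.
by rewrite -[RHS](w3 x); apply: eq_bigl => y; rewrite inE.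
Qed.

(** Of the three edges at [x], those into [X] leave the cut and the others enter it. *)
Lemma cut_addP x X : w x x = 0 -> x \notin X ->
  cut (x |: X) + 2 * edges [set x] X = cut X + 3.
Proof.
move=> wx xX; have := edges_setT (x |: X); have := edges_setT X.
rewrite !edges_regular cardsU1 xX edgesU1 // !(edgesC _ (_ |: _)) !edgesU1 //.
have -> : edges [set x] [set x] = 0 by rewrite edges1 big_set1.
rewrite (edgesC X [set x]); lia.
Qed.

Hypothesis conn : edge_connected3.
Hypothesis w0 : forall x, w x x = 0.

(** For [x != y] the cut around the pair has [6 - 2 * w x y] edges, and at least 3 because a third
    vertex exists. *)
Lemma weight_le1 : 2 < #|T| -> forall x y, w x y <= 1.
Proof.
move=> T2 x y; rewrite leqNgt; apply/negP=> wxy.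
have yx : y \notin [set x] by rewrite inE; apply: contraTneq wxy => ->; rewrite w0.
have := cut_addP (w0 y) yx; rewrite edges1 big_set1 w_sym.
have x0 : x \notin set0 by rewrite inE.
have := cut_addP (w0 x) x0; rewrite setU0 edgesC edges0 {2}/cut edges0.
have : 3 <= cut [set y; x]; last lia.
apply: conn; first by apply/set0Pn; exists x; rewrite !inE eqxx orbT.
apply/eqP=> yxT; have := cards2 y x; rewrite yxT cardsT; move: T2.
by case: (y != x) => /[swap] ->.
Qed.

(** If all four corners are nonempty, each has cut at least 3. Adding up opposite corners forces
    equality and excludes edges between opposite corners; then [cut X] is twice the number of edges
    between two adjacent corners, hence even. *)
Lemma laminar X Y : cut X = 3 -> cut Y = 3 -> X :|: Y != setT ->
  [\/ X \subset Y, Y \subset X | [disjoint X & Y]].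
Proof.
move=> cX cY XY; have /= [] := cut_corners X Y; rewrite cX cY.
have [|P1] := eqVneq (X :\: Y) set0.
  by move/eqP; rewrite setD_eq0 => *; constructor 1.
have [|P3] := eqVneq (Y :\: X) set0.
  by move/eqP; rewrite setD_eq0 => *; constructor 2.
have [|P2] := eqVneq (X :&: Y) set0.
  by move/eqP; rewrite setI_eq0 => *; constructor 3.
have P4 : ~: (X :|: Y) != set0 by apply: contraNneq XY => XY0; rewrite -[X :|: Y]setCK XY0 setC0.
have nT A (B : {set T}) : B \subset ~: A -> B != set0 -> A != setT.
  by move=> sBA; apply: contraNneq => AT; rewrite -subset0 -setCT -AT.
have c1 : 3 <= cut (X :\: Y).
  apply: conn => //; apply: (nT _ (Y :\: X)) => //; apply/subsetP=> x.
  by rewrite !inE; case: (x \in X); case: (x \in Y).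
have c2 : 3 <= cut (X :&: Y).
  apply: conn => //; apply: (nT _ (Y :\: X)) => //; apply/subsetP=> x.
  by rewrite !inE; case: (x \in X); case: (x \in Y).
have c3 : 3 <= cut (Y :\: X).
  apply: conn => //; apply: (nT _ (X :\: Y)) => //; apply/subsetP=> x.
  by rewrite !inE; case: (x \in X); case: (x \in Y).
have c4 : 3 <= cut (~: (X :|: Y)).
  apply: conn => //; apply: (nT _ (Y :\: X)) => //; apply/subsetP=> x.
  by rewrite !inE; case: (x \in X); case: (x \in Y).
by move=> *; lia.
Qed.

End Cuts.

(** * Connectivity of cubic graphs *)

Notation adjn G := (fun x y : vertex G => nat_of_bool (adj x y)).
Notation gedges := (@edges _ (adjn _)).
Notation gcut := (@cut _ (adjn _)).
Notation gconn G := (@edge_connected3 _ (adjn G)).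

Section SgraphCuts.
Variable G : sgraph.
Implicit Types (X Y : {set G}) (x y : G).

Lemma adjn_sym x y : adj x y = adj y x :> nat.
Proof. by rewrite adj_sym. Qed.

Lemma adjn_irr x : adj x x = 0 :> nat.
Proof. by rewrite adj_irr. Qed.

Lemma cubic_regular : cubic G <-> regular3 (adjn G).
Proof.
have E x : \sum_y adj x y = #|[set y | adj x y]|.
  rewrite -sum1dep_card [RHS]big_mkcond; apply: eq_bigr => y _ /=.
  by case: (adj x y).
by split=> h x; [rewrite E | rewrite -E].
Qed.

Hypothesis G3 : cubic G.

(** If fewer than 3 edges leave [X], their ends [S] in [X] separate [X :\: S] from the complement.
    If [X] is all of [S], it has at most two vertices, and degree 3 forces more edges out. *)
Lemma three_connected_cut : three_connected G -> gconn G.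
Proof.
case=> _ conn X X0 XT; rewrite leqNgt; apply/negP=> cX.
pose S := [set x in X | [exists y, (y \notin X) && adj x y]].
have sSX : S \subset X by apply/subsetP=> x; rewrite inE => /andP[].
have leS : #|S| <= gcut X.
  rewrite /cut (edgesID _ S) (setIidPr sSX) -sum1_card.
  apply: leq_trans (leq_addr _ _); apply: leq_sum => x.
  rewrite inE => /andP[_ /existsP[y /andP[yX xy]]].
  by rewrite (bigD1 y) ?inE //= xy.
have [XS|/set0Pn[u]] := eqVneq (X :\: S) set0.
  have {XS}leX : #|X| <= 2.
    rewrite -ltnS; apply: leq_ltn_trans (_ : #|X| <= #|S|) (leq_ltn_trans leS cX).
    by apply: subset_leq_card; rewrite -setD_eq0 XS.
  have : gedges X X <= #|X| * #|X|.-1.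
    rewrite -sum_nat_const; apply: leq_sum => x xX.
    rewrite (big_setD1 x) //= adj_irr (cardsD1 x X) xX /= -sum1_card.
    by apply: leq_sum => y _; case: (adj x y).
  have := edges_setT adjn_sym X; rewrite edges_regular; last exact/cubic_regular.
  have : 0 < #|X| by rewrite card_gt0.
  case: #|X| leX => [|[|[|]]] //= _ _; lia.
rewrite inE => /andP[uS uX].
have /set0Pn[v] : ~: X != set0.
  by apply: contraNneq XT => X0'; rewrite -[X]setCK X0' setC0.
rewrite inE => vX; have vS : v \notin S by apply: contra vX => /(subsetP sSX).
have := conn S (leq_ltn_trans leS cX) (exist _ u uS) (exist _ v vS).
move/(@closed_connect _ _ [pred z | val z \in X]); rewrite !inE /= uX (negPf vX).
suff cl : closed (@adj (del_vertices S)) [pred z | val z \in X] by move/(_ cl).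
have aux (x y : del_vertices S) : adj x y -> val x \in X -> val y \in X.
  move=> xy xX; apply: contraT => yX; case/negP: (valP x); rewrite inE xX.
  by apply/existsP; exists (val y); rewrite yX.
by move=> x y xy; rewrite !inE; apply/idP/idP; apply: aux; rewrite // adj_sym.
Qed.

(** Let [T] be the component of [u] off [S] and [U] the rest. Each sends at least 3 edges to [S],
    which has at most 6 to offer: so [S] has two vertices, no inner edge, and both cuts are exactly
    3. Moving [p] in [S] to either side keeps the cut at least 3, so [p] has at most one edge to
    each side, but three in all. *)
Lemma cut_three_connected : 0 < #|G| -> gconn G -> three_connected G.
Proof.
move=> /card_gt0P[x0 _] conn; split.
  rewrite -cardsT; apply: leq_trans (_ : #|x0 |: [set y | adj x0 y]| <= _).
    by rewrite cardsU1 inE adj_irr G3.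
  exact/subset_leq_card/subsetT.
move=> S S3 u v; apply: contraT => uv.
pose T := [set val x | x in [set x : del_vertices S | connect (@adj _) u x]].
pose U := ~: (S :|: T).
have dTS : [disjoint T & S].
  rewrite -setI_eq0 -subset0; apply/subsetP=> _ /setIP[/imsetP[x _ ->]].
  by rewrite (negPf (valP x)).
have TU0 : gedges T U = 0.
  rewrite /edges big1 // => z /imsetP[x]; rewrite inE => ux ->; rewrite big1 // => y.
  rewrite !inE negb_or => /andP[yS yT]; case xy: (adj _ _) => //.
  case/negP: yT; apply/imsetP; exists (Sub y yS) => //; rewrite inE.
  by apply: connect_trans ux (connect1 _).
have uT : val u \in T by apply/imsetP; exists u; rewrite ?inE.
have vU : val v \in U.
  rewrite !inE negb_or (valP v); apply/imsetP=> -[x]; rewrite inE => ux /val_inj vx.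
  by rewrite vx ux in uv.
have s3 Z : gedges Z setT = gedges Z S + gedges Z T + gedges Z U.
  rewrite !(edgesC adjn_sym Z) (edgesID _ S) setTI setTD (edgesID _ T (~: S)).
  have -> : ~: S :&: T = T.
    apply/setIidPr/subsetP=> z zT; rewrite inE; apply/negP=> zS.
    by have := disjointFr dTS zT; rewrite zS.
  by rewrite (_ : ~: S :\: T = U) ?addnA // setDE -setCU.
have reg := proj1 cubic_regular G3.
have cT := edges_setT adjn_sym T; have cU := edges_setT adjn_sym U.
have cS := edges_regular reg S; rewrite !s3 ?(edgesC adjn_sym _ S) in cT cU cS.
rewrite (edgesC adjn_sym U T) TU0 in cT cU.
have c3T : 3 <= gcut T.
  apply: conn; first by apply/set0Pn; exists (val u).
  by apply: contraTneq vU => TT; rewrite inE TT setUT inE.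
have c3U : 3 <= gcut U.
  apply: conn; first by apply/set0Pn; exists (val v).
  by apply: contraTneq uT => /setP/(_ (val u)); rewrite !inE negb_or => /andP[].
have S2 : #|S| == 2 by lia.
have [p [q [pq Spq]]] := cards2P _ S2.
have pS : p \in S by rewrite Spq !inE eqxx.
have [pT pU] : p \notin T /\ p \notin U.
  split; last by rewrite !inE pS.
  by apply/negP=> /(disjointFr dTS); rewrite pS.
have dT := cut_addP adjn_sym reg (adjn_irr p) pT.
have dU := cut_addP adjn_sym reg (adjn_irr p) pU.
have pS0 : gedges [set p] S = 0.
  by have := @leq_edges _ _ adjn_sym [set p] S S S; rewrite sub1set pS => /(_ isT (subxx _)); lia.
have := edges_regular reg [set p]; rewrite s3 cards1 pS0.
have : 3 <= gcut (p |: T).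
  apply: conn; first by apply/set0Pn; exists p; rewrite !inE eqxx.
  apply: contraTneq vU => /setP/(_ (val v)); rewrite !inE => /orP[/eqP->|->];
    by rewrite ?pS ?orbT.
have : 3 <= gcut (p |: U).
  apply: conn; first by apply/set0Pn; exists p; rewrite !inE eqxx.
  apply: contraTneq uT => /setP/(_ (val u)); rewrite !inE => /orP[/eqP->|] //.
  by rewrite negb_or => /andP[].
by have: 1 < 2 by []; lia.
Qed.

Lemma edge_connected_stable X : gconn G -> X != set0 ->
  (forall x y, x \in X -> adj x y -> y \in X) -> X = setT.
Proof.
move=> conn X0 Xst; apply/eqP; apply: contraT => XT.
have := conn X X0 XT; rewrite /cut /edges big1 // => x xX; rewrite big1 // => y.
by rewrite inE; case xy: (adj x y) => //; rewrite (Xst x).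
Qed.

Lemma edge_connected_n_comp : 0 < #|G| -> gconn G ->
  n_comp (@adj G) [pred x | true] = 1.
Proof.
move=> /card_gt0P[x0 _] conn; have csym : connect_sym (@adj G).
  by apply: sym_connect_sym; apply: adj_sym.
have E : [set y | connect (@adj G) x0 y] = setT.
  apply: edge_connected_stable => //; first by apply/set0Pn; exists x0; rewrite inE.
  by move=> y z; rewrite !inE => h1 /connect1; apply: connect_trans.
rewrite -(n_comp_connect csym x0); apply: eq_n_comp_r => x.
by have /setP/(_ x) := E; rewrite !inE => ->.
Qed.
End SgraphCuts.

(** * Rotation systems of cubic graphs *)

Lemma card_invariant_porbits_on (T U : finType) (p : {perm T}) (W : {set T}) (g : T -> U) :
  {in W, forall x, p x \in W} -> {in ~: W, forall x, p x = x} ->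
  {in W, forall x, g (p x) = g x} -> #|~: W| + #|g @: W| <= #|porbits p|.
Proof.
move=> pW pWc gp; pose h x : T + U := if x \in W then inr (g x) else inl x.
have hp x : h (p x) = h x.
  rewrite /h; have [xW|xW] := boolP (x \in W); first by rewrite pW // gp.
  by rewrite pWc ?inE // (negPf xW).
apply: leq_trans (card_invariant_porbits hp).
rewrite -(card_imset _ (@inl_inj T U)) -(card_imset _ (@inr_inj T U)) -cardsUI.
rewrite [X in _ + X]eq_card0 ?addn0 => [|u]; last first.
  by rewrite !inE; apply/negP=> /andP[/imsetP[x _ ->] /imsetP[]].
apply/subset_leq_card/subsetP=> u /setUP[/imsetP[x xW ->]|/imsetP[_ /imsetP[x xW ->] ->]];
  apply/imsetP; exists x; rewrite // /h ?xW //.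
by rewrite inE in xW; rewrite ifN.
Qed.

Section Darts.
Variable G : sgraph.
Implicit Types (X Y Z : {set G}) (x y : G) (d : dart G).

Local Notation flip := (Defs.flip G).

Lemma flipK : involutive flip.
Proof. by move=> d; apply/val_inj; rewrite !permE; case: d => -[]. Qed.

Lemma source_flip d : source (flip d) = (val d).2.
Proof. by rewrite permE. Qed.

Lemma dart_adj d : adj (source d) (source (flip d)).
Proof. by rewrite source_flip; apply: (valP d). Qed.

Lemma dart_ext d d' : source d = source d' -> source (flip d) = source (flip d') -> d = d'.
Proof.
rewrite !source_flip /source => e1 e2; apply/val_inj.
by case: (val d) (val d') e1 e2 => [a b] [c e] /= -> ->.
Qed.

Lemma dart_exists x y : adj x y -> exists d, source d = x /\ source (flip d) = y.
Proof. by move=> xy; exists (exist _ (x, y) xy); rewrite source_flip. Qed.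

Lemma flip_neq d : flip d != d.
Proof.
apply/eqP=> fd; have := dart_adj d; rewrite fd adj_irr; exact: negP.
Qed.

Definition darts X Y := [set d | (source d \in X) && (source (flip d) \in Y)].

Lemma card_darts X Y : #|darts X Y| = gedges X Y.
Proof.
rewrite /edges pair_big /= -sum1dep_card big_mkcond /= [RHS]big_mkcond /=.
pose F (p : G * G) := nat_of_bool [&& adj p.1 p.2, p.1 \in X & p.2 \in Y].
rewrite (eq_bigr (fun d : dart G => F (val d))) => [|d _]; last first.
  by rewrite /F (valP d) /= source_flip; case: (_ && _).
rewrite -(big_sub [pred p : G * G | adj p.1 p.2]) big_mkcond; apply: eq_bigr => -[x y] _.
by rewrite /F !inE /=; case: adj; case: (x \in X); case: (y \in Y).
Qed.

Lemma porbits_flip : 2 * #|porbits flip| = #|dart G|.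
Proof.
rewrite (porbits_involution flipK) eq_card0 ?addn0 // => d.
by rewrite inE (negPf (flip_neq d)).
Qed.

Lemma source_face (s : {perm dart G}) :
  (forall d, source (s d) = source d) -> forall d, source (face_perm s d) = source (flip d).
Proof. by move=> ss d; rewrite permM ss. Qed.

Hypothesis G3 : cubic G.
Let reg := proj1 (cubic_regular G) G3.

Lemma card_star x : #|[set d : dart G | source d == x]| = 3.
Proof.
transitivity #|darts [set x] setT|.
  by apply: eq_card => d; rewrite !inE andbT.
by rewrite card_darts edges_regular // cards1.
Qed.

Lemma card_dart : #|dart G| = 3 * #|G|.
Proof.
rewrite -!cardsT -(edges_regular reg) -card_darts; apply: eq_card => d.
by rewrite !inE.
Qed.

Lemma card_darts_from X : #|[set d : dart G | source d \in X]| = 3 * #|X|.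
Proof.
rewrite -(edges_regular reg) -card_darts; apply: eq_card => d.
by rewrite !inE andbT.
Qed.

Section Rotation.
Variable s : {perm dart G}.

(** An orbit of size 2 among the three darts at a vertex would leave the third one fixed. *)
Lemma cubic_rotation :
  (forall d, source (s d) = source d) -> (forall d, s d != d) -> rotation_system s.
Proof.
move=> ss sn d d'; have sub : porbit s d \subset [set d' | source d' == source d].
  by apply: porbit_stable; [move=> d1; rewrite !inE ss | rewrite inE].
suff -> : porbit s d = [set d' | source d' == source d] by rewrite inE.
apply/eqP; rewrite eqEcard sub card_star /= leqNgt; apply/negP=> lt3.
have O2 : 1 < #|porbit s d|.
  apply: leq_trans (subset_leq_card (_ : [set d; s d] \subset _)).
    by rewrite cards2 eq_sym sn.
  by rewrite subUset !sub1set porbit_step porbit_id.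
have : #|[set d' | source d' == source d] :\: porbit s d| == 1.
  by rewrite cardsD (setIidPr sub) card_star; move: lt3 O2; case: #|_| => [|[|[]]].
case/cards1P=> d1 D1; have := set11 d1; rewrite -D1 !inE => /andP[d1O d1s].
have : s d1 \in [set d1] by rewrite -D1 !inE ss d1s porbit_step d1O.
by rewrite inE (negPf (sn d1)).
Qed.

Hypothesis rot : rotation_system s.

Lemma source_rot d : source (s d) = source d.
Proof. by apply/eqP; rewrite -rot porbit_step porbit_id. Qed.

Lemma card_porbit_rot d : #|porbit s d| = 3.
Proof. by rewrite -(card_star (source d)); apply: eq_card => d'; rewrite rot inE. Qed.

Lemma rot3 d : s (s (s d)) = d.
Proof. by have := iter_porbit s d; rewrite card_porbit_rot. Qed.

Lemma rot_neq d : (s d != d) * (s (s d) != d).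
Proof.
have := uniq_traject_porbit s d; rewrite card_porbit_rot /= !inE negb_or !(eq_sym d).
by case/and3P=> /andP[-> ->].
Qed.

Lemma rot_cases d d' : source d' = source d -> [\/ d' = d, d' = s d | d' = s (s d)].
Proof.
move/eqP; rewrite -rot porbit_traject card_porbit_rot /= !inE.
by case/or3P=> /eqP; [constructor 1|constructor 2|constructor 3].
Qed.

Lemma porbits_rot : #|porbits s| = #|G|.
Proof.
have := sum_porbits s (fun=> 1); rewrite sum1_card card_dart.
rewrite (eq_bigr (fun=> 3)) => [|_ /imsetP[d _ ->]]; last by rewrite sum1_card card_porbit_rot.
by rewrite sum_nat_const mulnC => /eqP; rewrite eqn_pmul2l // => /eqP.
Qed.

Lemma stable_source (S : {set dart G}) : {in S, forall d, s d \in S} ->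
  forall d, (d \in S) = (source d \in [set source d | d in S]).
Proof.
move=> Ss d; apply/idP/imsetP=> [dS|[d' d'S dd']]; first by exists d.
by apply: (subsetP (porbit_stable Ss d'S)); rewrite rot dd'.
Qed.

Hypothesis conn : gconn G.
Hypothesis G0 : 0 < #|G|.
Local Notation f := (face_perm s).

Let dart0 : exists d : dart G, true.
Proof.
have [x _] := card_gt0P G0; have : 0 < #|[set d : dart G | source d == x]|.
  by rewrite card_star.
by case/card_gt0P=> d _; exists d.
Qed.

Lemma source_stable (S : {set dart G}) X : X = [set source d | d in S] ->
  S != set0 -> {in S, forall d, s d \in S} ->
  gcut X < 3 -> S = setT.
Proof.
move=> defX S0 Ss cX; apply/setP=> d; rewrite (stable_source Ss) inE -defX.
suff -> : X = setT by rewrite inE.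
apply/eqP; apply: contraTT cX => XT; rewrite -leqNgt; apply: conn => //.
by have [d' d'S] := set0Pn _ S0; apply/set0Pn; exists (source d'); rewrite defX imset_f.
Qed.

Lemma cut_flip_stable (S : {set dart G}) (D : {set dart G}) :
  {in S, forall d, s d \in S} -> {in S, forall d, d \notin D -> flip d \in S} ->
  gcut [set source d | d in S] <= #|D|.
Proof.
move=> Ss Sf; rewrite /cut -card_darts; apply/subset_leq_card/subsetP=> d.
rewrite !inE -!stable_source // => /andP[dS]; apply: contraR; exact: Sf.
Qed.

(** One marked dart is enough: by [conn], no proper nonempty set of darts is stable under both
    [flip] and [s]. *)
Lemma faces_le : 2 * #|porbits f| <= #|G| + 4.
Proof.
have [d0 _] := dart0.
have : #|porbits flip| + #|porbits s| + #|porbits f| <= #|dart G| + 2 * #|[set d0]|.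
  apply: euler_inequality => S S0 Se Ss; suff -> : S = setT by rewrite setTI -card_gt0 cards1.
  apply: (source_stable (erefl _)) => //; apply: leq_ltn_trans (@cut_flip_stable _ set0 _ _) _ => //.
    by move=> d dS _; apply: Se.
  by rewrite cards0.
have := porbits_flip; rewrite porbits_rot card_dart cards1; lia.
Qed.

Lemma plane_embeddingE : plane_embedding s <-> 2 * #|porbits f| = #|G| + 4.
Proof.
rewrite /plane_embedding (edge_connected_n_comp G0 conn) /n_faces.
have -> : #|[set x : G | [forall y, ~~ adj x y]]| = 0.
  apply: eq_card0 => x; rewrite !inE; apply/forallP=> nx.
  have := G3 x; rewrite eq_card0 // => y; rewrite inE; apply/negbTE/nx.
have := porbits_flip; rewrite card_dart.
by split=> [[_ h]|h]; [lia|split=> //; lia].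
Qed.

Hypothesis faces : 2 * #|porbits f| = #|G| + 4.

(** Composing [flip] with the transposition cuts the edge open: one more orbit of [flip], and one
    more face if both sides of the edge were on the same one. The map stays connected, so the genus
    inequality would be violated. *)
Lemma no_bridge d : flip d \notin porbit f d.
Proof.
apply/negP=> dO.
have : #|porbits (tperm d (flip d) * flip)| + #|porbits s| +
       #|porbits (tperm d (flip d) * flip * s)| <= #|dart G| + 2 * #|[set d]|.
  apply: euler_inequality => S S0 Se Ss.
  suff -> : S = setT by rewrite setTI -card_gt0 cards1.
  apply: (source_stable (erefl _)) => //.
  apply: leq_ltn_trans (@cut_flip_stable _ [set d; flip d] _ _) _ => //.
    move=> d' d'S; rewrite !inE negb_or => /andP[d1 d2]; have := Se _ d'S.
    by rewrite permM tpermD // eq_sym.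
  by rewrite cards2; case: eqP.
have /= := porbits_mul_tperm flip d (flip d).
have /= := porbits_mul_tperm f d (flip d); rewrite mulgA !(eq_sym d) flip_neq porbit_sym dO.
rewrite (porbit_sym flip) porbit_step porbit_id /= !addn0 => -> ->.
rewrite porbits_rot card_dart cards1.
have aux (e1 g f1 : nat) : 2 * e1 = 3 * g -> 2 * f1 = g + 4 ->
  e1 + 1 + g + (f1 + 1) <= 3 * g + 2 * 1 -> False by lia.
by apply: aux faces; rewrite porbits_flip card_dart.
Qed.

End Rotation.
End Darts.

(** * Faces on one side of a 3-edge-cut *)

Section ThreeCutFaces.
Variables (G : sgraph) (s : {perm dart G}).
Hypotheses (G3 : cubic G) (conn : gconn G) (G0 : 0 < #|G|).
Hypotheses (rot : rotation_system s) (faces : 2 * #|porbits (face_perm s)| = #|G| + 4).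
Implicit Types (X Y Z : {set G}) (x y : G) (d : dart G) (O : {set dart G}).
Local Notation flip := (Defs.flip G).
Local Notation f := (face_perm s).
Let reg := proj1 (cubic_regular G) G3.
Let asym := @adjn_sym G.
Let source_f := source_face (source_rot rot).

Definition from X := [set d : dart G | source d \in X].
Definition faces_in X := [set O in porbits f | O \subset from X].

(* The genus inequality for the part of the map carried by [Z], the three darts
   that leave [Z] being cut into half-edges: they lie on at least one further
   face. *)
Lemma faces_in_bound Z : gcut Z = 3 -> 2 * #|faces_in Z| < #|Z|.
Proof.
move=> cZ; pose inner d := (source d \in Z) && (source (flip d) \in Z).
(* A dart leaving [Z] is fixed by [e0] and becomes a half-edge; darts outside [Z] are fixed by both
   [e0] and [n0]. *)
pose e0 d := if inner d then flip d else d.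
pose n0 d := if source d \in Z then s d else d.
have e0K : involutive e0.
  have inner_flip d : inner (flip d) = inner d by rewrite /inner flipK andbC.
  by move=> d; rewrite /e0; case: (boolP (inner d)) => h; rewrite ?inner_flip ?h ?flipK ?(negPf h).
have n0_inj : injective n0.
  move=> d d'; rewrite /n0; case: ifP => dZ; case: ifP => d'Z //.
  - exact: perm_inj.
  - by move=> h; rewrite -h source_rot ?dZ in d'Z.
  - by move=> h; rewrite h source_rot ?d'Z in dZ.
pose e := perm (inv_inj e0K); pose n := perm n0_inj.
have Ze : 2 * #|porbits e| = #|dart G| + #|~: darts Z Z|.
  rewrite porbits_involution => [|d]; last by rewrite !permE e0K.
  congr (_ + _); apply: eq_card => d; rewrite !inE permE /e0 -/(inner d).
  by case: (inner d); rewrite ?eqxx ?(negPf (flip_neq d)).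
have cardW : #|from Z| = 3 * #|Z| by apply: card_darts_from.
have cardWc : #|~: from Z| = 3 * #|G| - 3 * #|Z|.
  by rewrite -cardW -(card_dart G3) -(cardsC (from Z)) addKn.
have ZG : #|Z| <= #|G| := max_card _.
have cardZZ : #|darts Z Z| + 3 = 3 * #|Z|.
  by have := edges_setT asym Z; rewrite (edges_regular reg) cZ card_darts.
have cardZZc : #|~: darts Z Z| = 3 * #|G| - #|darts Z Z|.
  by rewrite -(card_dart G3) -(cardsC (darts Z Z)) addKn.
have [z0 z0Z] : exists z, z \in Z.
  by apply/set0Pn; apply: contraPneq cZ => ->; rewrite /cut edges0.
have nW d : d \in from Z -> n d \in from Z.
  by rewrite !inE permE /n0 => dZ; rewrite dZ source_rot.
have nWc d : d \in ~: from Z -> n d = d by rewrite !inE permE /n0 => /negPf ->.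
have eW d : d \in from Z -> e d \in from Z.
  by rewrite !inE permE /e0; case: ifP => // /andP[].
have eWc d : d \in ~: from Z -> e d = d by rewrite !inE permE /e0 /inner => /negPf ->.
have Zn : #|~: from Z| + #|Z| <= #|porbits n|.
  apply: leq_trans (card_invariant_porbits_on (g := @source G) nW nWc _).
    rewrite leq_add2l; apply/subset_leq_card/subsetP=> z zZ.
    have : 0 < #|[set d : dart G | source d == z]| by rewrite card_star.
    case/card_gt0P=> d; rewrite inE => /eqP dz; apply/imsetP; exists d => //.
    by rewrite inE dz.
  by move=> d; rewrite inE permE /n0 => ->; rewrite source_rot.
(* All faces not contained in [Z] share the value [None], which a dart leaving [Z] takes: this is
   the [.+1] in [Zf]. *)
pose g d := if porbit f d \subset from Z then Some (porbit f d) else None.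
have gf d : g (f d) = g d.
  rewrite /g (_ : porbit f (f d) = porbit f d) //.
  by apply/eqP; rewrite eq_porbit_mem porbit_step porbit_id.
have gout d d' : d' \in porbit f d -> d' \notin from Z -> g d = None.
  by move=> dd' d'Z; rewrite /g ifN //; apply: contra d'Z => /subsetP; apply.
have Zf : #|~: from Z| + #|faces_in Z|.+1 <= #|porbits (e * n)%g|.
  apply: leq_trans (card_invariant_porbits_on (W := from Z) (g := g) _ _ _).
  - rewrite leq_add2l -add1n -[1](cards1 (@None {set dart G})).
    rewrite -(card_imset (mem (faces_in Z)) (@Some_inj _)) -cardsUI.
    rewrite [X in _ + X]eq_card0 ?addn0 => [|u]; last first.
      by rewrite !inE; apply/negP=> /andP[/eqP-> /imsetP[]].
    apply/subset_leq_card/subsetP=> u; rewrite inE => /orP[/set1P->|].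
      have : 0 < #|darts Z (~: Z)| by rewrite card_darts -/(gcut Z) cZ.
      case/card_gt0P=> d; rewrite !inE => /andP[dZ fdZ].
      apply/imsetP; exists d; rewrite ?inE //; symmetry; apply: (gout _ (f d)).
        by rewrite porbit_step porbit_id.
      by rewrite inE source_f.
    case/imsetP=> O; rewrite inE => /andP[/imsetP[d _ ->] sub] ->.
    apply/imsetP; exists d; last by rewrite /g sub.
    by apply: (subsetP sub); apply: porbit_id.
  - by move=> d dZ; rewrite permM nW ?eW.
  - by move=> d dZ; rewrite permM eWc ?nWc.
  - move=> d; rewrite inE permM !permE /n0 /e0 /inner => dZ; rewrite dZ /=.
    have [fdZ|fdZ] := boolP (source (flip d) \in Z); first by rewrite fdZ -[RHS]gf permM.
    rewrite dZ (gout d (f d)) ?inE ?source_f // ?porbit_step ?porbit_id //.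
    rewrite (gout (s d) (flip d)) ?inE //.
    rewrite porbit_sym (_ : s d = f (flip d)) ?porbit_step ?porbit_id //.
    by rewrite permM flipK.
have [d0] : exists d : dart G, d \in from Z.
  by apply/card_gt0P; rewrite cardW muln_gt0 card_gt0; apply/set0Pn; exists z0.
rewrite inE => d0Z.
have d0W : d0 \notin ~: from Z by rewrite !inE d0Z.
(* Each dart outside [Z] is a component of its own and gets a mark. The single mark [d0] serves [Z],
   which is connected: two parts with no edge between them would each have cut at least 3, against 3
   in total. *)
have : #|porbits e| + #|porbits n| + #|porbits (e * n)%g| <=
    #|dart G| + 2 * #|d0 |: ~: from Z|.
  apply: euler_inequality => S S0 Se Sn.
  have [|SZ] := boolP (S \subset from Z); last first.
    have [d dS dZ] := subsetPn SZ.
    by apply/set0Pn; exists d; rewrite !inE dS; rewrite inE in dZ; rewrite dZ orbT.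
  move=> /subsetP SZ; have Ss : {in S, forall d, s d \in S}.
    by move=> d dS; have := SZ d dS; have := Sn d dS; rewrite inE permE /n0 => + dZ; rewrite dZ.
  pose X := [set source d | d in S].
  have sXZ : X \subset Z.
    by apply/subsetP=> _ /imsetP[d /SZ dZ ->]; rewrite inE in dZ.
  have eX : gedges X (Z :\: X) = 0.
    rewrite -card_darts; apply: eq_card0 => d; rewrite !inE -!(stable_source rot) //.
    apply/negP=> /and3P[dS nfd fdZ]; have := Se d dS.
    have := SZ d dS; rewrite inE permE /e0 /inner => ->; rewrite fdZ /=.
    by apply/negP.
  have [|ZX] := eqVneq (Z :\: X) set0.
    move/eqP; rewrite setD_eq0 => /subsetP/(_ _ d0Z); rewrite -(stable_source rot) // => d0S.
    by apply/set0Pn; exists d0; rewrite !inE eqxx d0S.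
  have [] := cut_corners asym Z X; rewrite (setIidPr sXZ).
  have -> : X :\: Z = set0 by apply/eqP; rewrite setD_eq0.
  rewrite !(edgesC asym _ X) eX cZ ?(edgesC asym _ set0) !edges0.
  have c1 : 3 <= gcut X.
    apply: conn; last first.
      by apply: contraNneq ZX => XT; rewrite XT setDT.
    by have [d dS] := set0Pn _ S0; apply/set0Pn; exists (source d); apply: imset_f.
  have c2 : 3 <= gcut (Z :\: X).
    apply: conn => //; have [d dS] := set0Pn _ S0.
    apply/eqP=> /setP/(_ (source d)); rewrite !inE -(stable_source rot) // dS.
    by rewrite andFb.
  by move=> *; lia.
rewrite cardsU1 d0W; move: Ze; rewrite card_dart // cardZZc cardWc in Zn Zf *.
by lia.
Qed.


Lemma crossing_exit X d : source d \in X ->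
  (exists2 d', d' \in porbit f d & source d' \notin X) ->
  exists2 d', d' \in porbit f d & d' \in darts X (~: X).
Proof.
move=> dX [d' dd' d'X].
have [/existsP[d1 /andP[h1 h2]]|] := boolP [exists d1, (d1 \in porbit f d) && (d1 \in darts X (~: X))].
  by exists d1.
rewrite negb_exists => /forallP no; case/negP: d'X.
have st : {in porbit f d :&: from X, forall d1, f d1 \in porbit f d :&: from X}.
  move=> d1; rewrite !inE porbit_step source_f => /andP[h1 h2].
  by have := no d1; rewrite h1 !inE h2 /= negbK.
have dI : d \in porbit f d :&: from X by rewrite !inE porbit_id.
by have := subsetP (porbit_stable st dI) d' dd'; rewrite !inE => /andP[].
Qed.

Definition crossing X := porbits f :\: (faces_in X :|: faces_in (~: X)).

Lemma crossingP X O : O \in crossing X -> exists2 d, d \in darts X (~: X) &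
  O = porbit f d /\ exists2 d', d' \in darts (~: X) X & d' \in O.
Proof.
rewrite !inE negb_or => /andP[/andP[+ +] Of]; rewrite Of /= => nX nXc.
have [d0 d0O] : exists d0, O = porbit f d0 by case/imsetP: Of => d _; exists d.
have [dz dzO dzX] := subsetPn nX; have [dx dxO dxX] := subsetPn nXc.
rewrite !inE in dzX; rewrite !inE negbK in dxX.
have E d : d \in O -> O = porbit f d.
  by rewrite d0O -eq_porbit_mem => /eqP.
have [|d dO dc] := @crossing_exit X dx dxX; first by exists dz; rewrite -?(E _ dxO).
rewrite -(E _ dxO) in dO; exists d => //; split; first exact: E.
have [||d' d'O d'c] := @crossing_exit (~: X) dz; rewrite ?inE //.
  by exists dx; rewrite ?inE ?negbK // -(E _ dzO).
by exists d'; [rewrite setCK in d'c | rewrite -(E _ dzO) in d'O].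
Qed.

Lemma card_faces X : #|porbits f| = #|faces_in X| + #|faces_in (~: X)| + #|crossing X|.
Proof.
have sub : faces_in X :|: faces_in (~: X) \subset porbits f.
  by apply/subsetP=> O; rewrite !inE => /orP[] /andP[].
rewrite -(cardsID (faces_in X :|: faces_in (~: X))) (setIidPr sub); congr (_ + _).
rewrite cardsU [X in _ - X]eq_card0 ?subn0 // => O; rewrite !inE.
apply/negP=> /andP[/andP[/imsetP[d _ ->] /subsetP/(_ d (porbit_id _ _)) h1]].
move=> /andP[_ /subsetP/(_ d (porbit_id _ _))].
by rewrite inE in h1; rewrite !inE h1.
Qed.

(** Colours alternate along a face, so its length is even; length 2 would make [s] fix a dart. What
    matters is that a face not of length 4 has length at least 6. *)
Lemma face_even O : bipartite G -> O \in porbits f -> 4 <= #|O| /\ #|O| != 5.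
Proof.
move=> [c bip] /imsetP[d _ ->]; set O' := porbit f d.
pose B := [set d in O' | c (source d)].
have cf d' : c (source (f d')) = ~~ c (source d').
  rewrite source_f; have := bip _ _ (dart_adj d').
  by case: (c _); case: (c _).
have BW : #|B| = #|O' :\: B|.
  apply/eqP; rewrite eqn_leq -{1}(card_imset B (@perm_inj _ f)).
  rewrite -[X in _ && (X <= _)](card_imset _ (@perm_inj _ f)).
  apply/andP; split; apply/subset_leq_card/subsetP=> _ /imsetP[d' + ->];
    rewrite !inE porbit_step cf.
    by case/andP=> -> ->.
  by rewrite andbC => /andP[-> /=].
have sBO : B \subset O' by apply/subsetP=> d'; rewrite inE => /andP[].
have cO : #|O'| = 2 * #|B|.
  by rewrite -(cardsID B O') (setIidPr sBO) -BW mul2n addnn.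
have O0 : #|O'| != 0 := card_porbit_neq0 f d.
have O2 : #|O'| != 2.
  apply/eqP=> O2; have := iter_porbit f d; rewrite -/O' O2 /= => ffd.
  have fd : f d = flip d.
    by apply: dart_ext; rewrite ?source_f // -source_f ffd flipK.
  by have /eqP := fd; rewrite permM (negPf (rot_neq G3 rot _).1).
lia.
Qed.

Section Cut.
Variable X : {set G}.
Hypothesis cX : gcut X = 3.

Let cXc : gcut (~: X) = 3.
Proof. by rewrite (cutC asym). Qed.

Let crossing_sub : crossing X \subset porbit f @: darts X (~: X).
Proof.
by apply/subsetP=> O /crossingP[d dc [-> _]]; apply: imset_f.
Qed.

(** Each crossing face uses one of the three darts leaving [X], so there are at most 3;
    [faces_in_bound] on both sides leaves at least 3 of the faces required by Euler's formula. *)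
Let card_crossing : #|crossing X| = 3 /\ #|porbit f @: darts X (~: X)| = #|darts X (~: X)|.
Proof.
have := subset_leq_card crossing_sub; have := leq_imset_card (porbit f) (darts X (~: X)).
rewrite [#|_ (darts _ _)|]card_darts -/(gcut X) cX.
have := faces_in_bound cX; have := faces_in_bound cXc.
have := cardsC X; have := card_faces X; move: faces; lia.
Qed.

(** This is what makes the rotation at the new vertex of a contraction injective. *)
Lemma crossing_inj : {in darts X (~: X) &, injective (porbit f)}.
Proof. by apply/imset_injP/eqP; case: card_crossing. Qed.

(** Count the [3 * #|X|] darts at [X]. The bound on the other side gives [2a >= #|X| - 1] for the
    number [a] of faces inside [X]. Without a 4-face, each of these takes at least 6 darts and each
    of the three crossing faces at least 2, and [6a + 6] exceeds [3 * #|X|]. *)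
Lemma four_face : bipartite G -> 1 < #|X| -> exists2 O, O \in faces_in X & #|O| = 4.
Proof.
move=> bip X1; have [/exists_inP[O OX /eqP O4]|no4] := boolP [exists O in faces_in X, #|O| == 4].
  by exists O.
exfalso; have le6 O : O \in faces_in X -> 6 <= \sum_(d in O) (d \in from X).
  move=> OX; have := OX; rewrite inE => /andP[Of /subsetP sub].
  rewrite (eq_bigr (fun=> 1)) => [|d /sub -> //]; rewrite sum1_card.
  have [] := face_even bip Of; move: no4; rewrite negb_exists => /forallP/(_ O).
  rewrite OX /=; lia.
have le2 O : O \in crossing X -> 2 <= \sum_(d in O) (d \in from X).
  case/crossingP=> d dc [-> [d' d'c d'O]].
  (* The face enters [X] at [f d'] and leaves it by [d]. If these coincide, their source has two
     edges out of [X], and moving it across leaves a cut of at most 2. *)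
  have fd' : f d' != d.
    apply/eqP=> fd'; move: dc d'c; rewrite !inE => /andP[dX dZ] /andP[d'Z d'X].
    have dfd' : d != flip d'.
      by apply/eqP=> h; have := (rot_neq G3 rot d).1; rewrite {1}h -fd' permM eqxx.
    have xX : source d \notin ~: X by rewrite inE negbK.
    have := cut_addP asym reg (adjn_irr _) xX; rewrite cXc.
    have : #|[set d; flip d']| <= gedges [set source d] (~: X).
      rewrite -card_darts; apply/subset_leq_card/subsetP=> d1.
      by case/set2P=> ->; rewrite !inE ?flipK ?eqxx // -fd' source_f eqxx.
    rewrite cards2 dfd'; have : 3 <= gcut (source d |: ~: X).
      apply: conn; first by apply/set0Pn; exists (source d); rewrite !inE eqxx.
      have : 0 < #|X :\ source d| by move: X1; rewrite (cardsD1 (source d) X) dX.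
      case/card_gt0P=> z; rewrite !inE => /andP[zd zX].
      by apply/eqP=> /setP/(_ z); rewrite !inE (negPf zd) zX.
    by lia.
  rewrite (bigD1 d) ?porbit_id // (bigD1 (f d')) /=; last by rewrite porbit_step d'O.
  move: dc d'c; rewrite !inE source_f => /andP[-> _] /andP[_ ->]; lia.
have := sum_porbits f (fun d => d \in from X).
rewrite (big_setID (faces_in X)) /= [Y in _ + Y](big_setID (crossing X)) /=.
have -> : \sum_d (d \in from X) = 3 * #|X|.
  by rewrite -(card_darts_from G3) -sum1_card [RHS]big_mkcond; apply: eq_bigr => d _; case: (_ \in _).
have -> : porbits f :&: faces_in X = faces_in X.
  by apply/setIidPr/subsetP=> O; rewrite inE => /andP[].
have -> : (porbits f :\: faces_in X) :&: crossing X = crossing X.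
  by apply/setIidPr/subsetP=> O; rewrite !inE negb_or -andbA => /and3P[-> _ ->].
have : \sum_(O in faces_in X) 6 <= \sum_(O in faces_in X) \sum_(d in O) (d \in from X).
  exact: leq_sum.
have : \sum_(O in crossing X) 2 <= \sum_(O in crossing X) \sum_(d in O) (d \in from X).
  exact: leq_sum.
rewrite !sum_nat_const.
have := faces_in_bound cX; have := faces_in_bound cXc.
have := cardsC X; have := card_faces X; case: card_crossing => -> _; move: faces.
have aux (F V a b x z s1 s2 r : nat) : 2 * F = V + 4 -> F = a + b + 3 -> x + z = V ->
  2 * b < z -> 2 * a < x -> 3 * 2 <= s2 -> a * 6 <= s1 -> s1 + (s2 + r) = 3 * x -> False by lia.
exact: aux.
Qed.
End Cut.

(** Faces have length at least 4, so [4F <= 3V]; combine with [2F = V + 4]. *)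
Lemma card_ge8 : bipartite G -> 8 <= #|G|.
Proof.
move=> bip; have := sum_porbits f (fun=> 1); rewrite sum1_card card_dart // => sum.
have : \sum_(O in porbits f) 4 <= \sum_(O in porbits f) \sum_(d in O) 1.
  by apply: leq_sum => O /(face_even bip)[]; rewrite sum1_card.
rewrite sum sum_nat_const; move: faces; lia.
Qed.

(** Otherwise [6F <= 3V], against [2F = V + 4]. *)
Lemma four_face_all : bipartite G -> exists2 O, O \in porbits f & #|O| = 4.
Proof.
move=> bip; have [/exists_inP[O Of /eqP O4]|no4] := boolP [exists O in porbits f, #|O| == 4].
  by exists O.
exfalso; have := sum_porbits f (fun=> 1); rewrite sum1_card card_dart // => sum.
have : \sum_(O in porbits f) 6 <= \sum_(O in porbits f) \sum_(d in O) 1.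
  apply: leq_sum => O Of; have [] := face_even bip Of; rewrite sum1_card.
  by move: no4; rewrite negb_exists => /forallP/(_ O); rewrite Of /=; lia.
rewrite sum sum_nat_const; move: faces; lia.
Qed.
End ThreeCutFaces.

(** * Reduction R0 *)

Lemma cut_ext (T : finType) (w w' : T -> T -> nat) X :
  (forall x y, w x y = w' x y) -> cut w X = cut w' X.
Proof. by move=> e; do 2!(apply: eq_bigr => ? _). Qed.

Lemma edges_val (G : sgraph) (S : {set G}) (X Y : {set del_vertices S}) :
  gedges (val @: X) (val @: Y) = \sum_(u in X) \sum_(v in Y) adj (val u) (val v).
Proof.
rewrite /edges big_imset /=; last by move=> ? ? _ _; apply: val_inj.
by apply: eq_bigr => u _; rewrite big_imset //= => ? ? _ _; apply: val_inj.
Qed.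

Lemma uniq_map_inj (T U : eqType) (g : T -> U) (r : seq T) :
  uniq (map g r) -> {in r &, injective g}.
Proof.
elim: r => // a r IHr /= /andP[nar ur] x y; rewrite !inE.
case/predU1P=> [->|xr] /predU1P[->|yr] // gxy; last exact: IHr.
  by rewrite gxy map_f in nar.
by rewrite -gxy map_f in nar.
Qed.

Lemma count_le1_eq (T : eqType) (P : pred T) (r : seq T) x y :
  count P r <= 1 -> x \in r -> y \in r -> P x -> P y -> x = y.
Proof.
rewrite -size_filter => + xr yr Px Py.
have : x \in filter P r by rewrite mem_filter Px.
have : y \in filter P r by rewrite mem_filter Py.
by case: (filter P r) => [|z [|]] //; rewrite !inE => /eqP-> /eqP->.
Qed.

Section Square.
Variable G : sgraph.
Implicit Types (a b x y z : G) (X : {set G}).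

Definition nbrs a x y z := uniq [:: x; y; z] /\ forall v, adj a v = (v \in [:: x; y; z]).

Lemma edges_nbrs a x y z X : nbrs a x y z ->
  gedges [set a] X = (x \in X) + (y \in X) + (z \in X).
Proof.
case=> u3 nb; rewrite edges1 -addnA.
rewrite [LHS](_ : _ = \sum_(v <- [:: x; y; z]) (v \in X)).
  by rewrite !big_cons big_nil addn0.
rewrite (big_uniq _ u3) [LHS]big_mkcond [RHS]big_mkcond; apply: eq_bigr => v _.
by rewrite nb; case: (_ \in X); case: (_ \in [:: _; _; _]).
Qed.

Definition square a1 a2 a3 a4 b1 b2 b3 b4 :=
  [/\ uniq [:: a1; a2; a3; a4], all [predC [:: a1; a2; a3; a4]] [:: b1; b2; b3; b4],
      nbrs a1 a2 a4 b1, nbrs a2 a3 a1 b2 & nbrs a3 a4 a2 b3 /\ nbrs a4 a1 a3 b4].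

Lemma square_rot a1 a2 a3 a4 b1 b2 b3 b4 :
  square a1 a2 a3 a4 b1 b2 b3 b4 -> square a2 a3 a4 a1 b2 b3 b4 b1.
Proof.
case=> u4 nb n1 n2 [n3 n4]; split=> //.
  by rewrite -(rot_uniq 1) in u4.
have E : [:: a2; a3; a4; a1] =i [:: a1; a2; a3; a4] by move=> v; rewrite (mem_rot 1 [:: _; _; _; _]).
by move: nb; rewrite /= !E => /and5P[-> -> -> ->].
Qed.

End Square.

Section R0Graph.
Variables (G : sgraph) (a1 a2 a3 a4 b1 b2 b3 b4 : G).
Hypotheses (G3 : cubic G) (conn : gconn G) (bip : bipartite G) (G8 : 8 <= #|G|).
Hypothesis sq : square a1 a2 a3 a4 b1 b2 b3 b4.
(** The edges [a2 a3] and [a4 a1] cross such a cut and disappear in the reduction, so 5 edges are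
    needed to keep 3. *)
Hypothesis good : forall X : {set G},
  [/\ a1 \in X, a2 \in X, b1 \in X & b2 \in X] ->
  [/\ a3 \notin X, a4 \notin X, b3 \notin X & b4 \notin X] -> 4 < gcut X.

Let asym := @adjn_sym G.
Let reg := proj1 (cubic_regular G) G3.

Local Notation A := [set a1; a2; a3; a4].
Local Notation D := (del_vertices A).

Variables (B1 B2 B3 B4 : D).
Hypotheses (vB1 : val B1 = b1) (vB2 : val B2 = b2) (vB3 : val B3 = b3) (vB4 : val B4 = b4).

Definition R0_graph : sgraph := @add_edge (add_edge B1 B2) B3 B4.
Local Notation H := R0_graph.

(** Adjacency with multiplicity: [add_edge] would drop a parallel edge, and the degrees would no
    longer be 3. [R0_adjE] shows afterwards that nothing is dropped. *)
Definition R0_weight (u v : D) : nat :=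
  adj (val u) (val v) + ((u == B1) && (v == B2)) + ((u == B2) && (v == B1))
  + ((u == B3) && (v == B4)) + ((u == B4) && (v == B3)).
Local Notation w := R0_weight.

Lemma R0_weight_sym u v : w u v = w v u.
Proof.
rewrite /R0_weight adj_sym !(andbC (v == _)).
by rewrite [LHS]addnAC; congr (_ + _ + _); apply: addnAC.
Qed.

Let edgesA (X : {set G}) : [disjoint X & A] ->
  gedges X A = (b1 \in X) + (b2 \in X) + (b3 \in X) + (b4 \in X).
Proof.
move=> dX; have [u4 _ n1 n2 [n3 n4]] := sq.
have nX : (forall a, a \in A -> (a \in X) = false).
  by move=> a aA; apply/negP=> aX; have := disjointFr dX aX; rewrite aA.
move: u4; rewrite /= !inE !negb_or => /and4P[/and3P[a12 a13 a14] /andP[a23 a24] a34 _].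
rewrite edgesC // -!setUA !edgesU1 ?inE ?negb_or ?a12 ?a13 ?a14 ?a23 ?a24 ?a34 //.
rewrite (edges_nbrs _ n1) (edges_nbrs _ n2) (edges_nbrs _ n3) (edges_nbrs _ n4).
by rewrite !(nX a1, nX a2, nX a3, nX a4) ?inE ?eqxx ?orbT //= !add0n !addnA.
Qed.

Let memval (X : {set D}) (u : D) : (val u \in val @: X) = (u \in X).
Proof. by rewrite mem_imset //; apply: val_inj. Qed.

Let disj_val (X : {set D}) : [disjoint val @: X & A].
Proof.
rewrite -setI_eq0 -subset0; apply/subsetP=> _ /setIP[/imsetP[x _ ->]].
by rewrite (negPf (valP x)).
Qed.

Let setC_val (X : {set D}) : ~: (val @: X) = val @: (~: X) :|: A.
Proof.
apply/setP=> v; rewrite in_setU in_setC; have [vA|vA] := boolP (v \in A).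
  rewrite orbT; apply/negP=> vX; have := disjointFr (disj_val X) vX.
  by rewrite vA.
by rewrite orbF -[v]/(val (exist (fun x => x \notin A) v vA)) !memval inE.
Qed.

Let cut_val (X : {set D}) :
  gcut (val @: X) = \sum_(u in X) \sum_(v in ~: X) adj (val u) (val v)
   + ((B1 \in X) + (B2 \in X) + (B3 \in X) + (B4 \in X)).
Proof.
rewrite /cut setC_val edgesC // edgesU ?disj_val // -!(edgesC asym (val @: X)) edges_val.
by rewrite edgesA ?disj_val // -vB1 -vB2 -vB3 -vB4 !memval.
Qed.

Lemma R0_cut (X : {set D}) :
  cut w X = \sum_(u in X) \sum_(v in ~: X) adj (val u) (val v)
   + ((B1 \in X) (+) (B2 \in X)) + ((B3 \in X) (+) (B4 \in X)).
Proof.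
rewrite /cut /edges.
have ind (p q : D) : \sum_(u in X) \sum_(v in ~: X) ((u == p) && (v == q)) = (p \in X) && (q \notin X) :> nat.
  rewrite (eq_bigr (fun u => (u == p) * (q \notin X))) => [|u _]; last first.
    under eq_bigr => v _ do rewrite -mulnb.
    rewrite -big_distrr /=; congr (_ * _); rewrite (big_setID [set q]) /=.
    rewrite [Y in _ + Y]big1 ?addn0 => [|v]; last by rewrite !inE => /andP[/negPf->].
    have [qX|qX] := boolP (q \in X).
      by rewrite big1 // => v; rewrite !inE => /andP[+ /eqP vq]; rewrite vq qX.
    rewrite (setIidPr _) ?big_set1 ?eqxx // sub1set inE //.
  rewrite -big_distrl /= -mulnb; congr (_ * _); rewrite (big_setID [set p]) /=.
  rewrite [Y in _ + Y]big1 ?addn0 => [|v]; last by rewrite !inE => /andP[/negPf->].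
  have [pX|pX] := boolP (p \in X).
    by rewrite (setIidPr _) ?big_set1 ?eqxx // sub1set.
  by rewrite big1 // => v; rewrite !inE => /andP[+ /eqP vp]; rewrite vp (negPf pX).
under eq_bigr => u _ do rewrite /R0_weight !big_split.
rewrite !big_split /= !ind -!addnA; congr (_ + _).
by case: (B1 \in X); case: (B2 \in X); case: (B3 \in X); case: (B4 \in X).
Qed.

Let big_pred1_pair (u p q : D) : \sum_v ((u == p) && (v == q)) = (u == p) :> nat.
Proof.
rewrite (bigD1 q) //= eqxx andbT big1 ?addn0 // => v /negPf->.
by rewrite andbF.
Qed.

Lemma R0_regular : regular3 w.
Proof.
move=> u; rewrite /R0_weight !big_split /= !big_pred1_pair.
have := edges_regular reg [set val u]; rewrite cards1.
have -> : setT = val @: [set: D] :|: A :> {set G}.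
  by have := setC_val set0; rewrite imset0 !setC0.
have := edgesA (X := [set val u]); rewrite disjoints1 (valP u) => /(_ isT).
move=> eA; rewrite (edgesC asym _ (_ :|: _)) edgesU ?disj_val // -!(edgesC asym [set val u]) eA.
rewrite -imset_set1 edges_val big_set1 -vB1 -vB2 -vB3 -vB4 !memval !inE.
rewrite (eq_bigl xpredT) => [|v]; last by rewrite inE.
by rewrite !(eq_sym u) !addnA.
Qed.

Let conn_val (X : {set D}) : X != set0 -> 2 < gcut (val @: X).
Proof.
move=> /set0Pn[u uX]; apply: conn; first by apply/set0Pn; exists (val u); apply: imset_f.
have a1X : a1 \notin val @: X.
  by apply/negP=> /(disjointFr (disj_val X)); rewrite !inE eqxx.
by apply: contraNneq a1X => ->; rewrite inE.
Qed.

(** Adding [a1] raises the cut by one, and adding [a2], which then has two neighbours inside, lowers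
    it again: the set to which [good] applies has the same cut. *)
Let good_val (X : {set D}) : B1 \in X -> B2 \in X -> B3 \notin X -> B4 \notin X ->
  4 < gcut (val @: X).
Proof.
move=> h1 h2 h3 h4; have [u4 bA n1 n2 [n3 n4]] := sq.
have nX a : a \in A -> (a \in val @: X) = false.
  by move=> aA; apply/negP=> aX; have := disjointFr (disj_val X) aX; rewrite aA.
have aX1 : a1 \notin val @: X by rewrite nX ?inE ?eqxx.
have aX2 : a2 \notin a1 |: val @: X.
  rewrite inE nX ?inE ?eqxx ?orbT // orbF eq_sym.
  by move: u4; rewrite /= !inE !negb_or => /and4P[/andP[-> _] _ _].
have := cut_addP asym reg (adjn_irr a1) aX1; have := cut_addP asym reg (adjn_irr a2) aX2.
rewrite (edges_nbrs _ n1) (edges_nbrs _ n2) !in_setU1.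
move: u4; rewrite /= !inE !negb_or => /and4P[/and3P[a12 a13 a14] /andP[a23 a24] a34 _].
move: bA => /= /and5P[+ + + + _]; rewrite !inE !negb_or.
move=> /and4P[b11 b12 b13 b14] /and4P[b21 b22 b23 b24] /and4P[b31 b32 b33 b34] /and4P[b41 b42 b43 b44].
rewrite !(nX a1, nX a2, nX a3, nX a4) ?inE ?eqxx ?orbT //.
rewrite (negPf b21) -vB1 -vB2 !memval h1 h2 (eq_sym a3) (negPf a13).
have := good (X := a2 |: (a1 |: val @: X)).
rewrite !in_setU1 !eqxx !orbT !(eq_sym a3) !(eq_sym a4).
rewrite (negPf a13) (negPf a14) (negPf a23) (negPf a24) (negPf b31) (negPf b32) (negPf b41) (negPf b42).
rewrite !(nX a1, nX a2, nX a3, nX a4) ?inE ?eqxx ?orbT // -vB1 -vB2 -vB3 -vB4.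
rewrite !memval h1 h2 !orbT (negPf h3) (negPf h4).
move=> /(_ (And4 isT isT isT isT))/(_ (And4 isT isT isT isT)).
have aux (c0 c1 c2 : nat) : 4 < c2 -> c2 + 2 * 2 = c1 + 3 -> c1 + 2 * 1 = c0 + 3 -> 4 < c0.
  by clear; lia.
exact: aux.
Qed.

(** By cases on which [Bi] lie in [X]. The cut in [G] around the image of [X] or of its complement
    gives the bound, unless [X] separates [B1], [B2] from [B3], [B4]: then two edges are lost and
    [good_val] is used. *)
Lemma R0_conn : edge_connected3 w.
Proof.
move=> X X0 XT; have XC0 : ~: X != set0.
  by apply: contraNneq XT => XC0; rewrite -[X]setCK XC0 setC0.
have := conn_val X0; have := conn_val XC0; have := @good_val X; have := @good_val (~: X).
rewrite R0_cut !cut_val setCK -!edges_val (edgesC asym (val @: ~: X)) !inE.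
move: (edges _ _ _) => e; move: (B1 \in X) (B2 \in X) (B3 \in X) (B4 \in X).
by clear; do 4!case; move=> /= g1 g2; try (have := g1 isT isT isT isT);
  try (have := g2 isT isT isT isT); lia.
Qed.

(** Walks [b1 a1 a2 b2] and [b3 a3 a4 b4] have length 3, so the new edges respect the old
    colouring. *)
Let bipB : exists2 c : G -> bool, (forall x y, adj x y -> c x != c y) &
  (c b1 != c b2) && (c b3 != c b4).
Proof.
have [c cG] := bip; exists c => //; have [_ _ n1 n2 [n3 n4]] := sq.
have [h1 h2 h3 h4] : [/\ adj a1 b1, adj a2 b2, adj a3 b3 & adj a4 b4].
  by rewrite n1.2 n2.2 n3.2 n4.2 !inE !eqxx !orbT.
have h12 : adj a1 a2 by rewrite n1.2 !inE eqxx.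
have h34 : adj a3 a4 by rewrite n3.2 !inE eqxx.
move: (cG _ _ h1) (cG _ _ h2) (cG _ _ h3) (cG _ _ h4) (cG _ _ h12) (cG _ _ h34).
by do 8![case: (c _)].
Qed.

Let B12 : B1 != B2.
Proof.
have [c _ /andP[+ _]] := bipB; rewrite -vB1 -vB2; apply: contraNneq => ->.
by rewrite eqxx.
Qed.

Let B34 : B3 != B4.
Proof.
have [c _ /andP[_]] := bipB; rewrite -vB3 -vB4; apply: contraNneq => ->.
by rewrite eqxx.
Qed.

Lemma card_R0 : #|H| + 4 = #|G|.
Proof.
rewrite -(cardsC A) addnC /= card_sig; congr (_ + _).
  have [u4 _ _ _ _] := sq; have /card_uniqP/= <- := u4.
  by apply: eq_card => v; rewrite !inE -!orbA.
by apply: eq_card => v; rewrite !inE.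
Qed.

Let w0 u : w u u = 0.
Proof.
rewrite /R0_weight adj_irr.
have aux p q : p != q -> (u == p) && (u == q) = false :> bool.
  by move=> pq; apply/negP=> /andP[/eqP up /eqP uq]; rewrite -up -uq eqxx in pq.
by rewrite !aux // eq_sym.
Qed.

Lemma R0_adjE (u v : H) : adj u v = w u v :> nat.
Proof.
have D2 : 2 < #|D|.
  by rewrite -(ltn_add2r 4) (_ : #|D| + 4 = #|G|) ?(leq_trans _ G8) //; apply: card_R0.
have := weight_le1 R0_weight_sym R0_regular R0_conn w0 D2 u v.
rewrite /= /add_edge_adj /= /add_edge_adj B12 B34 /= /del_adj /R0_weight.
by do 5![case: (adj _ _) || case: (_ && _)].
Qed.

Lemma R0_cubic : cubic H.
Proof.
apply/cubic_regular => u; rewrite -[RHS](R0_regular u).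
by apply: eq_bigr => v _; apply: R0_adjE.
Qed.

Lemma R0_gconn : gconn H.
Proof. by move=> X X0 XT; rewrite (cut_ext _ R0_adjE); apply: R0_conn. Qed.

Lemma R0_bipartite : bipartite H.
Proof.
have [c cG /andP[c12 c34]] := bipB; exists (fun u => c (val u)) => u v.
have cD (p q : D) : (c (val p) != c (val q)) ->
    (u == p) && (v == q) || (u == q) && (v == p) -> c (val u) != c (val v).
  by move=> pq /orP[] /andP[/eqP-> /eqP->]; rewrite // eq_sym.
rewrite /= /add_edge_adj /= /add_edge_adj => /orP[/orP[/cG //|]|] /andP[_]; apply: cD.
  by rewrite vB1 vB2.
by rewrite vB3 vB4.
Qed.

Section Planar.
Variable s : {perm dart G}.
Hypotheses (rot : rotation_system s) (faces : 2 * #|porbits (face_perm s)| = #|G| + 4).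
Local Notation f := (face_perm s).
Local Notation flip := (Defs.flip G).
Variables d1 d2 d3 d4 : dart G.
Hypotheses (fd1 : f d1 = d2) (fd2 : f d2 = d3) (fd3 : f d3 = d4) (fd4 : f d4 = d1).
Hypotheses (sd1 : source d1 = a1) (sd2 : source d2 = a2)
           (sd3 : source d3 = a3) (sd4 : source d4 = a4).
Hypotheses (td1 : source (flip (s d1)) = b1) (td2 : source (flip (s d2)) = b2)
           (td3 : source (flip (s d3)) = b3) (td4 : source (flip (s d4)) = b4).

Let source_f := source_face (source_rot rot).

(* The new edges of [H], with the neighbour in [A] that their first end loses. *)
Let new : seq (D * D * G) :=
  [:: (B1, B2, a1); (B2, B1, a2); (B3, B4, a3); (B4, B3, a4)].

Let new_weight u v : w u v = adj (val u) (val v) + count (fun q => q.1 == (u, v)) new.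
Proof.
rewrite /R0_weight /= !xpair_eqE !(eq_sym u) !(eq_sym v) -!addnA addn0.
by [].
Qed.

Let w_le1 u v : w u v <= 1.
Proof. by rewrite -R0_adjE; case: (adj _ _). Qed.

Let new_count q : q \in new -> 0 < count (fun q' => q'.1 == (q.1.1, q.1.2)) new.
Proof.
by move=> qn; rewrite -has_count; apply/hasP; exists q => //; rewrite -surjective_pairing.
Qed.

Let new_inj1 : {in new &, injective (fun q => q.1)}.
Proof.
move=> q q' qn q'n qq'.
apply: (count_le1_eq (P := fun q' => q'.1 == (q.1.1, q.1.2)) _ qn q'n).
- by apply: leq_trans (w_le1 q.1.1 q.1.2); rewrite new_weight leq_addl.
- by rewrite -surjective_pairing.
- by rewrite -surjective_pairing qq'.
Qed.

Let new_inj2 : {in new &, injective (fun q => q.2)}.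
Proof. by apply: uniq_map_inj; have [u4 _ _ _ _] := sq. Qed.

Let new_nonadj q : q \in new -> adj (val q.1.1) (val q.1.2) = false.
Proof.
move=> /new_count; have := w_le1 q.1.1 q.1.2; rewrite new_weight.
move=> w1 c0; apply/negP=> h; move: w1; rewrite h add1n ltnS leqn0 => /eqP e.
by rewrite e in c0.
Qed.

Let new_adj q : q \in new -> adj (q.1.1 : H) q.1.2.
Proof.
move=> /new_count c0; rewrite -(lt0b (adj _ _)) R0_adjE new_weight.
exact: leq_trans c0 (leq_addl _ _).
Qed.

Let adj_new (u v : H) : adj u v -> ~~ adj (val u) (val v) ->
  exists2 q, q \in new & q.1 = (u, v).
Proof.
move=> uv /negPf nuv; have := R0_adjE u v; rewrite uv new_weight nuv add0n.
move=> c1; have : has (fun q => q.1 == (u, v)) new by rewrite has_count -c1.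
by case/hasP=> q qn /eqP; exists q.
Qed.

(** On new edges this is not compatible with [flip]: the dart from [B1] to [B2] goes to the one from
    [b1] to [a1], its reverse to the one from [b2] to [a2]. *)
Let iota_spec (d : dart H) (d' : dart G) :=
  source d' = val (source d) /\
  (adj (val (source d)) (val (source (Defs.flip H d))) /\
     source (flip d') = val (source (Defs.flip H d)) \/
   exists2 q, q \in new & q = (source d, source (Defs.flip H d), source (flip d'))).

Let rot3' := rot3 G3 rot.

Let flip_sK (p q : dart G) : f p = q -> s (s q) = flip p.
Proof. by move=> <-; rewrite permM rot3'. Qed.

(** The face across the edge of [p] runs through [flip (s q)], [flip p], [s p]: it comes in along
    the third edge at [source q] and goes out along the one at [source p]. *)
Let across (p q : dart G) : f p = q -> s (flip (s p)) \in porbit f (flip (s q)).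
Proof.
move=> fpq; have E r : s (flip r) = f r by rewrite permM.
have E1 : f (flip (s q)) = flip p by rewrite permM (flipK (s q)) (flip_sK fpq).
have E2 : f (flip p) = s p by rewrite permM flipK.
by rewrite E !porbit_step -E2 -E1 !porbit_step porbit_id.
Qed.

Let far q : q \in new -> exists2 d', source d' = val q.1.1 & source (flip d') = q.2.
Proof.
rewrite !inE => /or4P[] /eqP->.
- by exists (flip (s d1)); rewrite ?flipK ?(source_rot rot) ?td1 ?vB1.
- by exists (flip (s d2)); rewrite ?flipK ?(source_rot rot) ?td2 ?vB2.
- by exists (flip (s d3)); rewrite ?flipK ?(source_rot rot) ?td3 ?vB3.
- by exists (flip (s d4)); rewrite ?flipK ?(source_rot rot) ?td4 ?vB4.
Qed.

(** Every face at a corner of the square, except the square itself, reaches a vertex that survives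
    in [H]. *)
Let corner p p' d : f p = p' -> p' \in porbit f d1 ->
  source (flip (s p)) \notin A -> source (flip (s p')) \notin A ->
  source d = source p' -> porbit f d != porbit f d1 ->
  exists2 d', d' \in porbit f d & source d' \notin A.
Proof.
move=> fp p'O bp bp' /(rot_cases G3 rot)[]->; rewrite eq_porbit_mem ?p'O // => _.
  by exists (f (s p')); rewrite ?porbit_step ?porbit_id ?source_f.
have E : f (s (s p')) = s p by rewrite (flip_sK fp) permM flipK.
by exists (f (s p)); rewrite ?source_f // -E !porbit_step porbit_id.
Qed.

(** Four vertices fewer allow for two faces fewer: the darts of [H] miss at most the square, and the
    transposition costs at most one more. *)
Lemma R0_planar : planar H.
Proof.
have [io ioP] : exists io : dart H -> dart G, forall d, iota_spec d (io d).
  apply: fin_all_exists => d; have dd := dart_adj d.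
  have [old|/(adj_new dd)[q qn q1]] := boolP (adj (val (source d)) (val (source (Defs.flip H d)))).
    by have [d' [h1 h2]] := dart_exists old; exists d'; split=> //; left.
  have [d' h1 h2] := far qn; exists d'; split; first by rewrite h1 q1.
  by right; exists q => //; rewrite h2 -q1 -surjective_pairing.
have io_new d q : q \in new -> q.1 = (source d, source (Defs.flip H d)) ->
    source (flip (io d)) = q.2.
  move=> qn q1; have [_ [[old _]|[q' q'n e]]] := ioP d.
    by have := new_nonadj qn; rewrite q1 old.
  by rewrite (new_inj1 qn q'n) ?q1 e.
have io_old (d : dart H) : adj (val (source d)) (val (source (Defs.flip H d))) ->
    source (flip (io d)) = val (source (Defs.flip H d)).
  move=> old; have [_ [[_ ->] //|[q qn e]]] := ioP d.
  by have := new_nonadj qn; rewrite e old.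
have mem1 : (B1, B2, a1) \in new by rewrite !inE eqxx.
have mem2 : (B2, B1, a2) \in new by rewrite !inE eqxx orbT.
have mem3 : (B3, B4, a3) \in new by rewrite !inE eqxx !orbT.
have mem4 : (B4, B3, a4) \in new by rewrite !inE eqxx !orbT.
have notA (u : D) : val u \in A = false := negPf (valP u).
have new2A q : q \in new -> q.2 \in A.
  by rewrite !inE => /or4P[] /eqP->; rewrite eqxx ?orbT.
have io_inj : injective io.
  move=> d d' dd'; have [h1 c] := ioP d; have [h1' c'] := ioP d'.
  rewrite -dd' in h1' c'; have e1 : source d = source d' by apply/val_inj; rewrite -h1.
  apply: dart_ext => //; case: c c' => [[_ h2]|[q qn e]] [[_ h2']|[q' q'n e']].
  - by apply/val_inj; rewrite -h2.
  - by have := new2A _ q'n; rewrite e' /= h2 notA.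
  - by have := new2A _ qn; rewrite e /= h2' notA.
  - by have := new_inj2 qn q'n; rewrite e e' => /(_ erefl)[].
have io_source d : source (io d) = val (source d) by have [] := ioP d.
have io_surj d' : source d' \notin A -> exists d, io d = d'.
  move=> d'A; pose u : H := exist (fun x => x \notin A) _ d'A.
  have [fd'A|fd'A] := boolP (source (flip d') \in A); last first.
    pose v : H := exist (fun x => x \notin A) _ fd'A.
    have uv : adj u v.
      rewrite -(lt0b (adj _ _)) R0_adjE new_weight /= (_ : adj _ _ = true) //; exact: dart_adj.
    have [d [h1 h2]] := dart_exists uv; exists d; apply: dart_ext.
      by rewrite io_source h1.
    by rewrite io_old ?h1 ?h2 //=; exact: dart_adj.
  have [q qn [q1 q2]] : exists2 q, q \in new & val q.1.1 = source d' /\ q.2 = source (flip d').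
    have [_ _ n1 n2 [n3 n4]] := sq; have := dart_adj d'; rewrite adj_sym.
    move: (d'A) fd'A; rewrite !inE !negb_or -!andbA => /and4P[x1 x2 x3 x4].
    rewrite -!orbA => /or4P[]/eqP->; rewrite ?(n1.2, n2.2, n3.2, n4.2) !inE
      ?(negPf x1) ?(negPf x2) ?(negPf x3) ?(negPf x4) /= => /eqP->.
    - by exists (B1, B2, a1); rewrite ?mem1.
    - by exists (B2, B1, a2); rewrite ?mem2.
    - by exists (B3, B4, a3); rewrite ?mem3.
    - by exists (B4, B3, a4); rewrite ?mem4.
  have [d [h1 h2]] := dart_exists (new_adj qn); exists d; apply: dart_ext.
    by rewrite io_source h1.
  by rewrite (io_new d q) // h1 h2 -surjective_pairing.
have [q iq] : exists q : {perm dart H}, forall d, io (q d) = s (io d).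
  apply: perm_pullback => // d; apply: io_surj.
  by rewrite (source_rot rot) io_source notA.
have sq' d : source (q d) = source d.
  by apply/val_inj; rewrite -!io_source iq (source_rot rot).
have nq d : q d != d by rewrite -(inj_eq io_inj) iq (rot_neq G3 rot).
have H0 : 0 < #|H| by rewrite -(ltn_add2r 4) card_R0 (leq_trans _ G8).
have rotq := cubic_rotation R0_cubic sq' nq.
exists q; apply/(plane_embeddingE R0_cubic rotq R0_gconn H0).
apply/eqP; rewrite eqn_leq (faces_le R0_cubic rotq R0_gconn H0) /=.
have [D12 [sD12 tD12]] := dart_exists (new_adj mem1).
have [D21 [sD21 tD21]] := dart_exists (new_adj mem2).
have [D34 [sD34 tD34]] := dart_exists (new_adj mem3).
have [D43 [sD43 tD43]] := dart_exists (new_adj mem4).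
have iD12 : io D12 = flip (s d1).
  by apply: dart_ext; rewrite ?flipK ?(source_rot rot) ?io_source
    ?sD12 ?td1 ?(io_new _ _ mem1) ?sD12 ?tD12.
have iD21 : io D21 = flip (s d2).
  by apply: dart_ext; rewrite ?flipK ?(source_rot rot) ?io_source
    ?sD21 ?td2 ?(io_new _ _ mem2) ?sD21 ?tD21.
have iD34 : io D34 = flip (s d3).
  by apply: dart_ext; rewrite ?flipK ?(source_rot rot) ?io_source
    ?sD34 ?td3 ?(io_new _ _ mem3) ?sD34 ?tD34.
have iD43 : io D43 = flip (s d4).
  by apply: dart_ext; rewrite ?flipK ?(source_rot rot) ?io_source
    ?sD43 ?td4 ?(io_new _ _ mem4) ?sD43 ?tD43.
have f12 : Defs.flip H D12 = D21 by apply: dart_ext; rewrite ?flipK ?sD12 ?sD21 ?tD12 ?tD21.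
have f34 : Defs.flip H D34 = D43 by apply: dart_ext; rewrite ?flipK ?sD34 ?sD43 ?tD34 ?tD43.
have f21 : Defs.flip H D21 = D12 by rewrite -f12 flipK.
have f43 : Defs.flip H D43 = D34 by rewrite -f34 flipK.
have iof d : io (face_perm q d) = s (io (Defs.flip H d)) by rewrite permM iq.
(* Removing the two edges of [A] between the new edges merges two faces across
   [A]: this is the transposition of the darts (B1, B2) and (B3, B4). *)
have D13 : D12 != D34.
  apply/eqP=> h; move: sD12 tD12; rewrite h sD34 tD34 /= => e1 e2.
  have := new_inj1 mem1 mem3; rewrite /= e1 e2 => /(_ erefl)[a13].
  by have [+ _ _ _ _] := sq; rewrite a13 /= !inE eqxx orbT.
pose q1 := (tperm D12 D34 * face_perm q)%g.
have q1E d : porbit f (io (q1 d)) = porbit f (io d).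
  have -> : q1 d = face_perm q (tperm D12 D34 d) by rewrite [LHS]permM.
  apply/eqP; rewrite eq_porbit_mem; have [_ [[old e]|[r rn e]]] := ioP d.
    have nD r (x : dart H) : r \in new -> source x = r.1.1 ->
        source (Defs.flip H x) = r.1.2 -> x != d.
      move=> rn h1 h2; apply: contraTneq old => <-.
      by rewrite h1 h2 new_nonadj.
    rewrite tpermD ?(nD _ D12 mem1) ?(nD _ D34 mem3) // iof.
    have -> : io (Defs.flip H d) = flip (io d).
      apply: dart_ext; rewrite ?io_source // flipK io_old ?flipK //.
      by rewrite adj_sym.
    by rewrite (_ : s (flip (io d)) = f (io d)) ?porbit_step ?porbit_id // permM.
  have isD r' (x : dart H) : r' \in new -> r = r' -> source x = r'.1.1 ->
      source (Defs.flip H x) = r'.1.2 -> d = x.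
    by move=> _ rr' h1 h2; apply: dart_ext; rewrite ?h1 ?h2 -rr' e.
  have nD r1 r2 (x1 x2 : dart H) : r1 \in new -> r2 \in new -> source x1 = r1.1.1 ->
      source (Defs.flip H x1) = r1.1.2 -> source x2 = r2.1.1 ->
      source (Defs.flip H x2) = r2.1.2 -> r1 != r2 -> x1 != x2.
    move=> m1 m2 h1 h2 h3 h4; apply: contraNneq => x12; apply/eqP/(new_inj1 m1 m2).
    by rewrite [r1.1]surjective_pairing [r2.1]surjective_pairing -h1 -h2 -h3 -h4 x12.
  have [u4 _ _ _ _] := sq; move: (u4); rewrite /= !inE !negb_or.
  move=> /and4P[/and3P[a12 a13 a14] /andP[a23 a24] a34 _].
  move: (rn); rewrite !inE => /or4P[]/eqP rq.
  - rewrite (isD _ _ mem1 rq sD12 tD12) tpermL iof f34 iD43 iD12; exact: across.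
  - rewrite (isD _ _ mem2 rq sD21 tD21) tpermD; last first.
    + by apply: (nD _ _ _ _ mem3 mem2) => //; rewrite xpair_eqE /= (eq_sym a3) (negPf a23) andbF.
    + by apply: (nD _ _ _ _ mem1 mem2) => //; rewrite xpair_eqE /= (negPf a12) andbF.
    rewrite iof f21 iD12 iD21; exact: across.
  - rewrite (isD _ _ mem3 rq sD34 tD34) tpermR iof f12 iD21 iD34; exact: across.
  - rewrite (isD _ _ mem4 rq sD43 tD43) tpermD; last first.
    + by apply: (nD _ _ _ _ mem3 mem4) => //; rewrite xpair_eqE /= (negPf a34) andbF.
    + by apply: (nD _ _ _ _ mem1 mem4) => //; rewrite xpair_eqE /= (negPf a14) andbF.
    rewrite iof f43 iD34 iD43; exact: across.
have leq1 := card_invariant_porbits q1E.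
have leq2 : #|porbits q1| <= #|porbits (face_perm q)| + 1.
  by have := porbits_mul_tperm (face_perm q) D12 D34; rewrite D13 /= => <-; apply: leq_addr.
have leq3 : #|porbits f| <= #|[set porbit f (io x) | x in setT]| + 1.
  rewrite (cardsD1 (porbit f d1)) imset_f // addnC leq_add2r.
  apply/subset_leq_card/subsetP=> O; rewrite !inE => /andP[Od1 /imsetP[d _ defO]].
  suff [d' d'O /io_surj[d0 d0d']] : exists2 d', d' \in O & source d' \notin A.
    apply/imsetP; exists d0 => //; apply/eqP; rewrite d0d' eq_sym.
    by rewrite defO eq_porbit_mem -defO.
  rewrite defO in Od1 *; have [dA|dA] := boolP (source d \in A); last first.
    by exists d; rewrite ?porbit_id.
  have bA (u : D) : val u \notin A by rewrite notA.
  have d2O : d2 \in porbit f d1 by rewrite -fd1 porbit_step porbit_id.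
  have d3O : d3 \in porbit f d1 by rewrite -fd2 porbit_step.
  have d4O : d4 \in porbit f d1 by rewrite -fd3 porbit_step.
  move: dA; rewrite !inE -!orbA => dA.
  have [bA1 bA2 bA3 bA4] : [/\ source (flip (s d1)) \notin A, source (flip (s d2)) \notin A,
      source (flip (s d3)) \notin A & source (flip (s d4)) \notin A].
    by rewrite td1 td2 td3 td4 -vB1 -vB2 -vB3 -vB4 !bA.
  have d1O := porbit_id f d1.
  by case/or4P: dA => /eqP sd; [apply: (corner fd4 _ _ _ (etrans sd (esym sd1)))
    |apply: (corner fd1 _ _ _ (etrans sd (esym sd2)))
    |apply: (corner fd2 _ _ _ (etrans sd (esym sd3)))
    |apply: (corner fd3 _ _ _ (etrans sd (esym sd4)))].
apply/leP; move: leq1 leq2 leq3 faces card_R0.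
have aux (x y z t g h : nat) : x <= y -> y <= z + 1 -> t <= x + 1 -> 2 * t = g + 4 ->
  h + 4 = g -> (h + 4 <= 2 * z)%coq_nat by clear; lia.
exact: aux.
Qed.
End Planar.
End R0Graph.

Lemma giso_refl G : giso G G.
Proof. by exists id => //; exists id. Qed.

Section Reduction.
Variables (G : sgraph) (s : {perm dart G}).
Hypotheses (G3 : cubic G) (conn : gconn G) (G0 : 0 < #|G|) (bip : bipartite G).
Hypotheses (rot : rotation_system s) (faces : 2 * #|porbits (face_perm s)| = #|G| + 4).
Local Notation flip := (Defs.flip G).
Local Notation f := (face_perm s).

Definition face_square d1 d2 d3 d4 :=
  [/\ f d1 = d2, f d2 = d3, f d3 = d4, f d4 = d1 &
      uniq [:: source d1; source d2; source d3; source d4]].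

Lemma face_square_rot d1 d2 d3 d4 : face_square d1 d2 d3 d4 -> face_square d2 d3 d4 d1.
Proof. by case=> ? ? ? ? u; split=> //; move: u; rewrite -(rot_uniq 1). Qed.

Definition third d := source (flip (s d)).

Lemma face_square_nbrs d1 d2 d3 d4 : face_square d1 d2 d3 d4 ->
  nbrs (source d1) (source d2) (source d4) (third d1).
Proof.
case=> f1 f2 f3 f4 u4.
have sf d : source (f d) = source (flip d) := source_face (source_rot rot) d.
have E2 : source d2 = source (flip d1) by rewrite -f1 sf.
have E4 : flip d4 = s (s d1) by rewrite -f4 permM (rot3 G3 rot).
have E4' : source d4 = source (flip (s (s d1))) by rewrite -E4 flipK.
split; last first.
  move=> v; rewrite !inE E2 E4' /third; apply/idP/idP => [/dart_exists[d [sd <-]]|].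
    by have [->|->|->] := rot_cases G3 rot sd; rewrite eqxx ?orbT.
  case/or3P=> /eqP->; first exact: dart_adj.
    by rewrite -(source_rot rot d1) -(source_rot rot (s d1)) dart_adj.
  by rewrite -(source_rot rot d1) dart_adj.
have inj d d' : source d = source d' -> d != d' -> source (flip d) != source (flip d').
  by move=> dd'; apply: contraNneq => /(dart_ext dd')->.
rewrite E2 E4' /third /= !inE negb_or !inj ?(source_rot rot) ?(rot_neq G3 rot) //;
  by rewrite eq_sym (rot_neq G3 rot).
Qed.

Lemma face_square_square d1 d2 d3 d4 : face_square d1 d2 d3 d4 ->
  square (source d1) (source d2) (source d3) (source d4)
    (third d1) (third d2) (third d3) (third d4).
Proof.
move=> h1; have h2 := face_square_rot h1; have h3 := face_square_rot h2.
have h4 := face_square_rot h3.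
have n1 := face_square_nbrs h1; have n2 := face_square_nbrs h2.
have n3 := face_square_nbrs h3; have n4 := face_square_nbrs h4.
split=> //; first by case: h1.
have [c cG] := bip.
(* The colouring is what separates [z] from the opposite corner [o], which has the colour of [a]. *)
have far (a x o y z : G) : nbrs a x y z -> adj x o -> z \notin [:: a; x; o; y].
  move=> [u ha] xo; rewrite !inE !negb_or; apply/and4P.
  have az : adj a z by rewrite ha !inE eqxx !orbT.
  have ax : adj a x by rewrite ha !inE eqxx.
  move: u; rewrite /= !inE negb_or !(eq_sym z) => /and3P[/andP[_ ->] -> _]; split=> //.
    by apply: contraTneq az => ->; rewrite adj_irr.
  move: (cG _ _ az); apply: contraTneq => <-; have := cG _ _ ax; have := cG _ _ xo.
  by case: (c a); case: (c x); case: (c o).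
have a23 : adj (source d2) (source d3) by rewrite n2.2 !inE eqxx.
have a34 : adj (source d3) (source d4) by rewrite n3.2 !inE eqxx.
have a41 : adj (source d4) (source d1) by rewrite n4.2 !inE eqxx.
have a12 : adj (source d1) (source d2) by rewrite n1.2 !inE eqxx.
have f1 := far _ _ _ _ _ n1 a23; have f2 := far _ _ _ _ _ n2 a34.
have f3 := far _ _ _ _ _ n3 a41; have f4 := far _ _ _ _ _ n4 a12.
rewrite -(mem_rot 3) /= in f2; rewrite -(mem_rot 2) /= in f3.
by rewrite -(mem_rot 1) /= in f4; apply/and5P.
Qed.

Lemma face_square_is_face d1 d2 d3 d4 : face_square d1 d2 d3 d4 ->
  is_face s [:: source d1; source d2; source d3; source d4].
Proof.
case=> f1 f2 f3 f4 u4; exists d1; rewrite /fingraph.orbit.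
have -> : fingraph.order f d1 = 4.
  rewrite (@order_cycle _ f [:: d1; d2; d3; d4]) ?inE ?eqxx //=.
    by rewrite f1 f2 f3 f4 !eqxx.
  exact: (map_uniq (f := @source G) (s := [:: d1; d2; d3; d4])) u4.
by rewrite /= f1 f2 f3.
Qed.

(** Only the choice of [b1 b2] and [b3 b4] is treated; the other choice is this one after
    [face_square_rot]. *)
Lemma R0_reduction d1 d2 d3 d4 : face_square d1 d2 d3 d4 ->
  (forall X : {set G},
    [/\ source d1 \in X, source d2 \in X, third d1 \in X & third d2 \in X] ->
    [/\ source d3 \notin X, source d4 \notin X, third d3 \notin X & third d4 \notin X] ->
    4 < gcut X) ->
  exists H, C3CBP H /\ R0 G H.
Proof.
move=> fs good; have sq := face_square_square fs.
have G8 := card_ge8 G3 G0 rot faces bip.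
pose A := [set source d1; source d2; source d3; source d4].
have memA x : (x \in A) = (x \in [:: source d1; source d2; source d3; source d4]).
  by rewrite !inE -!orbA.
have [u4 allb n1 n2 [n3 n4]] := sq.
have [bA1 bA2 bA3 bA4] : [/\ third d1 \notin A, third d2 \notin A, third d3 \notin A & third d4 \notin A].
  by rewrite !memA; case/and5P: allb.
pose B1 : del_vertices A := exist (fun x => x \notin A) _ bA1.
pose B2 : del_vertices A := exist (fun x => x \notin A) _ bA2.
pose B3 : del_vertices A := exist (fun x => x \notin A) _ bA3.
pose B4 : del_vertices A := exist (fun x => x \notin A) _ bA4.
have [v1 v2 v3 v4] : [/\ val B1 = third d1, val B2 = third d2, val B3 = third d3 & val B4 = third d4] by [].
exists (R0_graph B1 B2 B3 B4); split.
  have [f1 f2 f3 f4 _] := fs.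
  have H3 : cubic (R0_graph B1 B2 B3 B4).
    exact: (R0_cubic G3 conn bip G8 sq good v1 v2 v3 v4).
  have Hc : gconn (R0_graph B1 B2 B3 B4).
    exact: (R0_gconn G3 conn bip G8 sq good v1 v2 v3 v4).
  split=> //.
  - apply: cut_three_connected => //.
    by rewrite -(ltn_add2r 4) (card_R0 sq) (leq_trans _ G8).
  - exact: (R0_bipartite bip sq).
  - exact: (R0_planar G3 conn bip G8 sq good _ _ _ _ rot faces f1 f2 f3 f4).
exists (source d1), (source d2), (source d3), (source d4), B1, B2, B3, B4.
split=> //; last by left; apply: giso_refl.
  exists s; last exact: face_square_is_face.
  by apply/plane_embeddingE.
by split; [rewrite n1.2|rewrite n2.2|rewrite n3.2|rewrite n4.2]; rewrite !inE eqxx !orbT.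
Qed.

End Reduction.

(** * Contraction of one side of a 3-edge-cut *)

Lemma big_option (T : finType) (F : option T -> nat) :
  \sum_x F x = F None + \sum_x F (Some x).
Proof.
rewrite (bigD1 None) //=; congr (_ + _).
rewrite (reindex_omap Some id) => [|[x|]] //=.
by apply: eq_bigl => x; rewrite eqxx.
Qed.

Section Contraction.
Variables (G : sgraph) (s : {perm dart G}).
Hypotheses (G3 : cubic G) (conn : gconn G) (G0 : 0 < #|G|).
Hypotheses (rot : rotation_system s) (faces : 2 * #|porbits (face_perm s)| = #|G| + 4).
Variable Z : {set G}.
Hypotheses (cZ : gcut Z = 3) (Z1 : 1 < #|~: Z|).
Local Notation flip := (Defs.flip G).
Local Notation f := (face_perm s).
Let asym := @adjn_sym G.
Let reg := proj1 (cubic_regular G) G3.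
Local Notation D := (del_vertices Z).

Definition boundary : {set D} := [set v : D | [exists z in Z, adj (val v) z]].
Definition contraction := add_vertex boundary.
Local Notation H := contraction.

(** With two edges into [Z], moving [v] there would leave a nontrivial cut of at most 2. So
    contracting [Z] creates no parallel edges. *)
Let one_edge v : v \notin Z -> gedges [set v] Z <= 1.
Proof.
move=> vZ; have := cut_addP asym reg (adjn_irr _) vZ; rewrite cZ.
have : 3 <= gcut (v |: Z).
  apply: conn; first by apply/set0Pn; exists v; rewrite !inE eqxx.
  have : 0 < #|~: Z :\ v| by move: Z1; rewrite (cardsD1 v (~: Z)) inE vZ.
  case/card_gt0P=> z; rewrite !inE => /andP[zv zZ].
  by apply/eqP=> /setP/(_ z); rewrite !inE (negPf zv) (negPf zZ).
clear; lia.
Qed.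

Let boundaryE (v : D) : (v \in boundary) = gedges [set val v] Z :> nat.
Proof.
have := one_edge (valP v); rewrite inE; case: exists_inP => [[z zZ vz]|nz].
  suff : 0 < gedges [set val v] Z by case: (edges _ _ _) => [|[]].
  by rewrite edges1 (bigD1 z) //= vz.
move=> _; rewrite edges1 big1 // => z zZ; case vz: (adj _ _) => //.
by case: nz; exists z.
Qed.

Let val_setT : val @: [set: D] = ~: Z.
Proof.
apply/setP=> v; rewrite inE; apply/imsetP/idP => [[u _ ->]|vZ]; first exact: (valP u).
by exists (exist (fun x => x \notin Z) v vZ).
Qed.

Lemma contraction_cubic : cubic H.
Proof.
have sumD (F : G -> nat) : \sum_(v : D) F (val v) = \sum_(x in ~: Z) F x.
  rewrite -val_setT big_imset /=; last by move=> ? ? _ _; apply: val_inj.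
  by apply: eq_bigl => x; rewrite inE.
apply/cubic_regular => -[v|]; rewrite big_option /=; last first.
  rewrite add0n (eq_bigr (fun v : D => gedges [set val v] Z)) => [|v _]; last exact: boundaryE.
  rewrite (sumD (fun x => gedges [set x] Z)) -cZ /cut edgesC //.
  by apply: eq_bigr => x _; rewrite edges1.
rewrite boundaryE (sumD (fun x => adj (val v) x)) -(edges1 (adjn G)).
have := edges_regular reg [set val v]; rewrite cards1 muln1 => <-.
by rewrite edgesC // [RHS]edgesC // [RHS](edgesID _ Z) setTI setTD; congr (_ + _); apply: edgesC.
Qed.

(** A side avoiding the new vertex has as many vertices and inner edges as its image in [G], hence
    by regularity the same cut. *)
Lemma contraction_gconn : gconn H.
Proof.
have wlog_none (X : {set H}) : None \notin X -> X != set0 -> 3 <= gcut X.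
  move=> nX X0; pose Y := [set v : D | Some v \in X].
  have XY : X = Some @: Y.
    apply/setP=> -[v|]; first by rewrite mem_imset ?inE //; apply: Some_inj.
    by rewrite (negPf nX); apply/esym/negP=> /imsetP[].
  have Y0 : Y != set0 by apply: contraNneq X0 => Y0; rewrite XY Y0 imset0.
  have e1 : gedges X X = gedges (val @: Y) (val @: Y).
    rewrite edges_val XY /edges big_imset /=; last by move=> ? ? _ _ [].
    by apply: eq_bigr => u _; rewrite big_imset //= => ? ? _ _ [].
  have e2 : #|X| = #|val @: Y|.
    by rewrite XY !card_imset //; [apply: val_inj|apply: Some_inj].
  have : 3 <= gcut (val @: Y).
    apply: conn; first by have [v vY] := set0Pn _ Y0; apply/set0Pn; exists (val v); apply: imset_f.
    have : 0 < gcut Z by rewrite cZ.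
    rewrite lt0n; apply: contraNneq => YT.
    suff -> : Z = set0 by rewrite /cut edges0.
    apply/setP=> z; rewrite inE; apply/negP=> zZ; have := in_setT z.
    by rewrite -YT => /imsetP[v _ zv]; have := valP v; rewrite -zv zZ.
  have := edges_setT asym (val @: Y); have := edges_setT (@adjn_sym H) X.
  rewrite (edges_regular reg) (edges_regular (proj1 (cubic_regular H) contraction_cubic)) e1 e2.
  by move=> -> /addnI ->.
move=> X X0 XT; have [nX|nX] := boolP (None \in X); last exact: wlog_none.
rewrite -(cutC (@adjn_sym H)); apply: wlog_none; first by rewrite inE nX.
by apply: contraNneq XT => XC0; rewrite -[X]setCK XC0 setC0.
Qed.

Lemma card_contraction : #|H| = #|~: Z| + 1.
Proof. by rewrite /= card_option addn1 -val_setT card_imset ?cardsT //; apply: val_inj. Qed.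

Lemma contraction_bipartite (c : G -> bool) (b : bool) :
  (forall x y, adj x y -> c x != c y) ->
  (forall x z, x \notin Z -> z \in Z -> adj x z -> c x = b) -> bipartite H.
Proof.
move=> cG cb; exists (fun x => if x is Some v then c (val v) else ~~ b).
have Sb (v : D) : v \in boundary -> c (val v) = b.
  by rewrite inE => /exists_inP[z zZ vz]; apply: cb vz => //; apply: (valP v).
have nb (b' : bool) : b' != ~~ b' by case: b'.
move=> [u|] [v|] //=; first exact: cG.
  by move/Sb->.
by move/Sb->; rewrite eq_sym.
Qed.

(** The contraction map: [insub] sends [Z] to [None], which is the new vertex. *)
Let proj (x : G) : H := insub x.

Let projS (v : D) : proj (val v) = Some v.
Proof. exact: valK. Qed.

Let projN x : x \in Z -> proj x = None.
Proof. by move=> xZ; rewrite /proj insubF ?xZ. Qed.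

Let proj_eq x : x \notin Z -> exists2 v : D, val v = x & proj x = Some v.
Proof. by move=> xZ; exists (exist (fun x => x \notin Z) x xZ) => //; rewrite -projS. Qed.

Let proj_None x : (proj x == None) = (x \in Z).
Proof.
by case: (boolP (x \in Z)) => [/projN->|/proj_eq[v _ ->]].
Qed.

Let proj_inj x y : x \notin Z -> proj x = proj y -> x = y.
Proof.
move=> xZ pxy; have yZ : y \notin Z by rewrite -proj_None -pxy proj_None.
have [u xu pu] := proj_eq xZ; have [v yv pv] := proj_eq yZ.
by rewrite -xu -yv; move: pxy; rewrite pu pv => -[->].
Qed.

Let dart_unique d d' : ~~ ((source d \in Z) && (source (flip d) \in Z)) ->
  proj (source d) = proj (source d') -> proj (source (flip d)) = proj (source (flip d')) ->
  d = d'.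
Proof.
have main d1 d2 : source d1 \notin Z -> proj (source d1) = proj (source d2) ->
    proj (source (flip d1)) = proj (source (flip d2)) -> d1 = d2.
  move=> d1Z p1 p2; have e1 := proj_inj d1Z p1.
  have [fZ|fZ] := boolP (source (flip d1) \in Z); last first.
    by apply: dart_ext => //; apply: proj_inj.
  have fZ2 : source (flip d2) \in Z by rewrite -proj_None -p2 proj_None.
  have := one_edge d1Z; rewrite -card_darts => /card_le1_eqP; apply; rewrite !inE ?eqxx //.
  by rewrite -e1 eqxx.
rewrite negb_and => /orP[dZ|dZ] p1 p2; first exact: main.
by apply: (can_inj (@flipK G)); apply: main; rewrite ?flipK.
Qed.

Let proj_adj x y : adj x y -> ~~ ((x \in Z) && (y \in Z)) -> adj (proj x) (proj y).
Proof.
have main a b : adj a b -> a \notin Z -> adj (proj a) (proj b).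
  move=> ab /proj_eq[u ua ->]; have [bZ|/proj_eq[v vb ->]] := boolP (b \in Z).
    by rewrite projN //= inE; apply/exists_inP; exists b; rewrite ?ua.
  by rewrite /= /del_adj /= -[sval u]/(val u) -[sval v]/(val v) ua vb.
move=> xy; rewrite negb_and => /orP[h|h]; first exact: main.
by rewrite adj_sym; apply: main; rewrite // adj_sym.
Qed.

(** Every face of [G] not inside [Z] is reached by a dart of [H], and [faces_in_bound] keeps the
    number of lost faces within what Euler's formula for [H] allows. *)
Lemma contraction_planar : planar H.
Proof.
have [io io1 io2] : exists2 io : dart H -> dart G,
    (forall d, proj (source (io d)) = source d) &
    forall d, proj (source (flip (io d))) = source (Defs.flip H d).
  suff /fin_all_exists[io ioP] : forall d : dart H, exists d', proj (source d') = source d /\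
     proj (source (flip d')) = source (Defs.flip H d).
    by exists io => d; case: (ioP d).
  move=> d; have := dart_adj d; case: (source d) (source (Defs.flip H d)) => [u|] [v|] //=.
  - by move/dart_exists=> [d' [e1 e2]]; exists d'; rewrite e1 e2; split; apply: projS.
  - rewrite inE => /exists_inP[z zZ /dart_exists[d' [e1 e2]]].
    by exists d'; rewrite e1 e2 (projN zZ); split=> //; apply: projS.
  - rewrite inE => /exists_inP[z zZ /dart_exists[d' [e1 e2]]].
    by exists (flip d'); rewrite flipK e1 e2 (projN zZ); split=> //; apply: projS.
have io_out d : ~~ ((source (io d) \in Z) && (source (flip (io d)) \in Z)).
  rewrite -!proj_None io1 io2; apply/negP=> /andP[/eqP h1 /eqP h2].
  by have := dart_adj d; rewrite h1 h2.
have io_surj d' : ~~ ((source d' \in Z) && (source (flip d') \in Z)) -> exists d, io d = d'.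
  move=> out; have [d [h1 h2]] := dart_exists (proj_adj (dart_adj d') out).
  by exists d; apply/esym/dart_unique; rewrite ?io1 ?io2.
have io_inj : injective io.
  by move=> d d' dd'; apply: dart_ext; [rewrite -!io1 dd'|rewrite -!io2 dd'].
have io_flip d : io (Defs.flip H d) = flip (io d).
  apply: dart_unique; rewrite ?io1 ?io2 ?flipK ?io1 //.
have source_f d : source (f d) = source (flip d) := source_face (source_rot rot) d.
(* At the new vertex, the edge through which a face of [G] enters [Z] is followed
   by the edge through which that face leaves [Z]. *)
have [p [pX pZ pZZ]] : exists p : dart G -> dart G, [/\
    forall d, source d \notin Z -> p d = s d,
    forall d, d \in darts Z (~: Z) -> p d \in darts Z (~: Z) /\ p d \in porbit f (flip d) &
    forall d, source d \in Z -> source (flip d) \in Z -> p d = d].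
  suff /fin_all_exists[p pP] : forall d, exists d', [/\ source d \notin Z -> d' = s d,
      d \in darts Z (~: Z) -> d' \in darts Z (~: Z) /\ d' \in porbit f (flip d) &
      source d \in Z -> source (flip d) \in Z -> d' = d].
    by exists p; split=> d; case: (pP d).
  move=> d; have [dZ|dZ] := boolP (source d \in Z); last first.
    by exists (s d); split=> //; rewrite inE (negPf dZ).
  have [fZ|fZ] := boolP (source (flip d) \in Z).
    by exists d; split=> //; rewrite !inE fZ andbF.
  have eO : porbit f (f (flip d)) = porbit f (flip d).
    by apply/eqP; rewrite eq_porbit_mem porbit_step porbit_id.
  have [||d1 d1O d1c] := @crossing_exit _ _ rot Z (f (flip d)).
  - by rewrite source_f flipK.
  - by exists (flip d) => //; rewrite eO porbit_id.
  by rewrite eO in d1O; exists d1; split=> // h; rewrite h in dZ.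
have cases d : [\/ source d \notin Z, d \in darts Z (~: Z) | source d \in Z /\ source (flip d) \in Z].
  rewrite !inE; case: (boolP (source d \in Z)) => dZ; last by constructor 1.
  by case: (boolP (source (flip d) \in Z)) => fZ; [constructor 3|constructor 2].
have cX : gcut (~: Z) = 3 by rewrite (cutC asym).
have flip_dart d : d \in darts Z (~: Z) -> flip d \in darts (~: Z) (~: ~: Z).
  by rewrite !inE flipK negbK andbC.
have p_source d : (source (p d) \in Z) = (source d \in Z).
  have [h|h|[h1 h2]] := cases d; last by rewrite pZZ.
    by rewrite pX // (source_rot rot).
  by have [] := pZ d h; move: h; rewrite !inE => /andP[-> _] /andP[-> _].
have p_out d : (source d \in Z) && (source (flip d) \in Z) =
    (source (p d) \in Z) && (source (flip (p d)) \in Z).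
  have [h|h|[h1 h2]] := cases d; last by rewrite pZZ.
    by rewrite !p_source (negPf h).
  have [] := pZ d h; move: h; rewrite !inE => /andP[_ /negPf->] /andP[_ /negPf->].
  by rewrite !andbF.
have p_inj : injective p.
  move=> d d' pdd'; have e1 := p_source d; have e2 := p_out d.
  rewrite pdd' p_source in e1; rewrite pdd' -p_out in e2; move: e1 e2.
  have [h|h|[h1 h2]] := cases d.
  - rewrite (negPf h) => h' _; move: pdd'; rewrite !pX ?h' //; exact: perm_inj.
  - move: (h); rewrite !inE => /andP[-> /negPf fdZ]; rewrite fdZ => d'Z; rewrite d'Z /= => fd'Z.
    have h' : d' \in darts Z (~: Z) by rewrite !inE d'Z -fd'Z.
    have [_ p1] := pZ d h; have [_ p2] := pZ d' h'; rewrite pdd' in p1.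
    apply: (can_inj (@flipK G)); apply: (crossing_inj G3 conn G0 rot faces cX); rewrite ?flip_dart //.
    by move: p1 p2; rewrite -!eq_porbit_mem => /eqP<- /eqP<-.
  - by rewrite h1 h2 => d'Z; rewrite d'Z /= => fd'Z; move: pdd'; rewrite !pZZ.
have [q iq] : exists q : {perm dart H}, forall d, io (q d) = p (io d).
  suff [q iq] : exists q : {perm dart H}, forall d, io (q d) = perm p_inj (io d).
    by exists q => d; rewrite iq permE.
  apply: perm_pullback => // d; apply: io_surj; rewrite permE.
  by rewrite -p_out.
have sq d : source (q d) = source d.
  rewrite -!io1 iq; have [h|h|[h1 h2]] := cases (io d).
  - by rewrite pX // (source_rot rot).
  - have [] := pZ _ h; move: h; rewrite !inE => /andP[h1 _] /andP[h2 _] _.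
    by rewrite !projN.
  - by have := io_out d; rewrite h1 h2.
have nq d : q d != d.
  rewrite -(inj_eq io_inj) iq; have [h|h|[h1 h2]] := cases (io d).
  - by rewrite pX // (rot_neq G3 rot).
  (* If [p] fixed this dart, a face would enter and leave [Z] by the same edge and so lie on both
     sides of it. *)
  - have [_ pO] := pZ _ h; apply: contraTneq pO => ->.
    by rewrite -{1}[io d]flipK; apply: no_bridge.
  - by have := io_out d; rewrite h1 h2.
have H0 : 0 < #|H| by rewrite card_contraction addn1.
have rotq := cubic_rotation contraction_cubic sq nq.
exists q; apply/(plane_embeddingE contraction_cubic rotq contraction_gconn H0).
apply/eqP; rewrite eqn_leq (faces_le contraction_cubic rotq contraction_gconn H0) /=.
have fE d : porbit f (io (face_perm q d)) = porbit f (io d).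
  apply/eqP; rewrite eq_porbit_mem (_ : face_perm q d = q (Defs.flip H d)) ?permM // iq io_flip.
  have [h|h|[h1 h2]] := cases (flip (io d)).
  - by rewrite pX // (_ : s _ = f (io d)) ?porbit_step ?porbit_id // permM.
  - by have [_] := pZ _ h; rewrite flipK.
  - by rewrite flipK in h2; have := io_out d; rewrite h1 h2.
have leq1 := card_invariant_porbits fE.
have leq2 : #|porbits f| <= #|faces_in s Z| + #|[set porbit f (io x) | x in setT]|.
  rewrite -(cardsID (faces_in s Z) (porbits f)); apply: leq_add.
    exact/subset_leq_card/subsetIr.
  apply/subset_leq_card/subsetP=> O; rewrite !inE => /andP[+ Of]; rewrite Of /=.
  case/subsetPn=> d dO; rewrite inE => dZ.
  have [d0 d0d] : exists d0, io d0 = d by apply: io_surj; rewrite (negPf dZ).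
  apply/imsetP; exists d0 => //; case/imsetP: Of dO => d1 _ -> dO.
    by rewrite inE.
  by apply/esym/eqP; rewrite d0d eq_porbit_mem.
apply/leP; move: leq1 leq2 faces (faces_in_bound G3 conn G0 rot faces cZ)
  (cardsC Z) card_contraction.
have aux (x y t a z g h zc : nat) : x <= y -> t <= a + x -> 2 * t = g + 4 -> 2 * a < z ->
  z + zc = g -> h = zc + 1 -> (h + 4 <= 2 * y)%coq_nat by clear; lia.
exact: aux.
Qed.
End Contraction.

(** * Squares on which R0 fails *)

Section Corners.
Variable G : sgraph.
Hypotheses (G3 : cubic G) (conn : gconn G).
Let asym := @adjn_sym G.
Let reg := proj1 (cubic_regular G) G3.

Lemma nbrs_cubic (a x y z : G) : uniq [:: x; y; z] -> adj a x -> adj a y -> adj a z ->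
  nbrs a x y z.
Proof.
move=> u ax ay az; split=> // v.
suff -> : [:: x; y; z] =i [set v | adj a v] by rewrite inE.
apply/subset_cardP; first by rewrite G3; apply/card_uniqP.
by apply/subsetP=> w; rewrite !inE => /or3P[]/eqP->.
Qed.

(* The last three conditions say that contracting each [Qi] gives the cube. *)
Definition corners a1 a2 a3 a4 b1 b2 b3 b4 (Q1 Q2 Q3 Q4 : {set G}) :=
  [/\ square a1 a2 a3 a4 b1 b2 b3 b4,
      [/\ b1 \in Q1, b2 \in Q2, b3 \in Q3 & b4 \in Q4],
      forall v, (v \in [:: a1; a2; a3; a4]) + (v \in Q1) + (v \in Q2) + (v \in Q3) + (v \in Q4) = 1,
      [/\ gcut Q1 = 3, gcut Q2 = 3, gcut Q3 = 3 & gcut Q4 = 3]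
    & [/\ gedges Q1 Q2 = 1, gedges Q2 Q3 = 1, gedges Q3 Q4 = 1 & gedges Q4 Q1 = 1]].

Lemma corners_rot a1 a2 a3 a4 b1 b2 b3 b4 Q1 Q2 Q3 Q4 :
  corners a1 a2 a3 a4 b1 b2 b3 b4 Q1 Q2 Q3 Q4 ->
  corners a2 a3 a4 a1 b2 b3 b4 b1 Q2 Q3 Q4 Q1.
Proof.
case=> sq [? ? ? ?] part [? ? ? ?] [? ? ? ?]; split=> //; first exact: square_rot.
move=> v; have := part v.
have -> : (v \in [:: a2; a3; a4; a1]) = (v \in [:: a1; a2; a3; a4]).
  by rewrite (mem_rot 1 [:: _; _; _; _]).
clear; lia.
Qed.

(** [a] has one neighbour in [P] and two outside, so removing it lowers the cut by one; what remains
    contains [b] and has cut at least 3. *)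
Let corner_cut (P : {set G}) a x y b : nbrs a x y b -> a \in P -> b \in P ->
  x \notin P -> y \notin P ->
  [/\ 4 <= gcut P, gcut P = gcut (P :\ a) + 1 & gedges [set a] (P :\ a) = 1].
Proof.
move=> n aP bP xP yP; have := n.2 b; rewrite !inE eqxx !orbT => ab.
have ba : b != a by apply: contraTneq ab => ->; rewrite adj_irr.
have e1 : gedges [set a] (P :\ a) = 1.
  by rewrite (edges_nbrs _ n) !inE ba bP (negPf xP) (negPf yP) !andbF.
have aPa : a \notin P :\ a by rewrite !inE eqxx.
have := cut_addP asym reg (adjn_irr a) aPa; rewrite setD1K // e1.
have : 3 <= gcut (P :\ a).
  apply: conn; first by apply/set0Pn; exists b; rewrite !inE ba.
  by apply/eqP=> /setP/(_ a); rewrite !inE eqxx.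
by clear; split=> //; lia.
Qed.

Let corner_edge (P P' : {set G}) a a' : a \in P -> a' \in P' -> gedges [set a] P' = 1 ->
  gedges [set a'] (P :\ a) = 0 -> gedges P P' = 2 -> gedges (P :\ a) (P' :\ a') = 1.
Proof.
move=> aP aP' e1 e2; rewrite -{1}(setD1K aP) edgesU1 ?setD11 // e1.
rewrite -{1}(setD1K aP') (edgesC asym) edgesU1 ?setD11 // e2 (edgesC asym).
by clear; lia.
Qed.

(** Each corner of [X] and [Y] contains one [ai] with its [bi], so its cut is at least 4. As [X] and
    [Y] have cut at most 4, all corners have cut exactly 4, with 2 edges between consecutive corners
    and none between opposite ones. Of these 2 edges one belongs to the square; [Qi] is the corner
    without [ai]. *)
Lemma cut_corners_exist a1 a2 a3 a4 b1 b2 b3 b4 (X Y : {set G}) :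
  square a1 a2 a3 a4 b1 b2 b3 b4 -> gcut X <= 4 -> gcut Y <= 4 ->
  [/\ a1 \in X, a2 \in X, b1 \in X & b2 \in X] ->
  [/\ a3 \notin X, a4 \notin X, b3 \notin X & b4 \notin X] ->
  [/\ a2 \in Y, a3 \in Y, b2 \in Y & b3 \in Y] ->
  [/\ a4 \notin Y, a1 \notin Y, b4 \notin Y & b1 \notin Y] ->
  exists Q1 Q2 Q3 Q4, corners a1 a2 a3 a4 b1 b2 b3 b4 Q1 Q2 Q3 Q4.
Proof.
move=> sq cX cY [x1 x2 x3 x4] [x5 x6 x7 x8] [y1 y2 y3 y4] [y5 y6 y7 y8].
have [u4 nb n1 n2 [n3 n4]] := sq.
have /= [cXE cYE c1E c2E [c3E c4E]] := cut_corners asym X Y.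
set P1 := X :\: Y in cXE cYE c1E c2E c3E c4E; set P2 := X :&: Y in cXE cYE c1E c2E c3E c4E.
set P3 := Y :\: X in cXE cYE c1E c2E c3E c4E; set P4 := ~: _ in cXE cYE c1E c2E c3E c4E.
have ms := (x1, x2, x3, x4, negPf x5, negPf x6, negPf x7, negPf x8,
            y1, y2, y3, y4, negPf y5, negPf y6, negPf y7, negPf y8).
have [a1P a2P a3P a4P] : [/\ a1 \in P1, a2 \in P2, a3 \in P3 & a4 \in P4].
  by rewrite !inE !ms.
have [b1P b2P b3P b4P] : [/\ b1 \in P1, b2 \in P2, b3 \in P3 & b4 \in P4].
  by rewrite !inE !ms.
have [||c1 g1 h1] := corner_cut n1 a1P b1P; try by rewrite !inE !ms.
have [||c2 g2 h2] := corner_cut n2 a2P b2P; try by rewrite !inE !ms.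
have [||c3 g3 h3] := corner_cut n3 a3P b3P; try by rewrite !inE !ms.
have [||c4 g4 h4] := corner_cut n4 a4P b4P; try by rewrite !inE !ms.
have aux (k1 k2 k3 k4 kX kY m12 m13 m14 m23 m24 m34 : nat) :
    kX = m13 + m14 + m23 + m24 -> kY = m12 + m13 + m24 + m34 ->
    k1 = m12 + m13 + m14 -> k2 = m12 + m23 + m24 -> k3 = m13 + m23 + m34 ->
    k4 = m14 + m24 + m34 -> kX <= 4 -> kY <= 4 -> 4 <= k1 -> 4 <= k2 -> 4 <= k3 -> 4 <= k4 ->
    [/\ [/\ k1 = 4, k2 = 4, k3 = 4 & k4 = 4] & [/\ m12 = 2, m23 = 2, m34 = 2 & m14 = 2]].
  by clear; move=> *; do !split; lia.
have [[k1 k2 k3 k4] [e12 e23 e34 e14]] :=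
  aux _ _ _ _ _ _ _ _ _ _ _ _ cXE cYE c1E c2E c3E c4E cX cY c1 c2 c3 c4.
have pred4 (c c' : nat) : c = 4 -> c = c' + 1 -> c' = 3 by clear; lia.
exists (P1 :\ a1), (P2 :\ a2), (P3 :\ a3), (P4 :\ a4); split=> //.
- have ab (a x y b : G) : nbrs a x y b -> b != a.
    move=> [_ n]; have := n b; rewrite !inE eqxx !orbT => h.
    by apply: contraTneq h => ->; rewrite adj_irr.
  by rewrite !in_setD1 b1P b2P b3P b4P (ab _ _ _ _ n1) (ab _ _ _ _ n2) (ab _ _ _ _ n3) (ab _ _ _ _ n4).
- move: u4; rewrite /= !inE !negb_or => /and4P[/and3P[a12 a13 a14] /andP[a23 a24] a34 _] v.
  rewrite !in_setD1 !inE.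
  have [->|v1] := eqVneq v a1; first by rewrite ?(negPf a12, negPf a13, negPf a14) !ms.
  have [->|v2] := eqVneq v a2; first by rewrite ?(negPf a23, negPf a24) !ms.
  have [->|v3] := eqVneq v a3; first by rewrite ?(negPf a34) !ms.
  have [->|v4] := eqVneq v a4; first by rewrite !ms.
  by case: (v \in X); case: (v \in Y).
- by split; [exact: (pred4 _ _ k1 g1)|exact: (pred4 _ _ k2 g2)
    |exact: (pred4 _ _ k3 g3)|exact: (pred4 _ _ k4 g4)].
- split; apply: corner_edge => //;
    rewrite ?(edges_nbrs _ n1, edges_nbrs _ n2, edges_nbrs _ n3, edges_nbrs _ n4)
      ?in_setD1 ?inE ?ms ?andbF ?eqxx //.
  by rewrite (edgesC asym).
Qed.

Lemma corner_triv (Q : {set G}) b : b \in Q -> #|Q| <= 1 -> Q = [set b].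
Proof. by move=> bQ Q1; apply/esym/eqP; rewrite eqEcard sub1set bQ cards1. Qed.

Section CornerCuts.
Variables (a1 a2 a3 a4 b1 b2 b3 b4 : G) (Q1 Q2 Q3 Q4 : {set G}).
Hypothesis cs : corners a1 a2 a3 a4 b1 b2 b3 b4 Q1 Q2 Q3 Q4.

Lemma corner_edge_pos a x y b (Q : {set G}) : nbrs a x y b -> b \in Q -> 0 < gedges [set a] Q.
Proof. by move=> n bQ; rewrite (edges_nbrs _ n) bQ addn1. Qed.

(** By laminarity [Q1] lies in [Z]. As [Z :\: Q1] has cut at least 3, at most one edge of [Q1]
    leaves [Z], and the edge to [a1] does; so the edges to [Q2] and [Q4] stay in [Z]. *)
Lemma corner_meets (Z : {set G}) : gcut Z = 3 -> {in [:: a1; a2; a3; a4], forall a, a \notin Z} ->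
  ~~ [disjoint Q1 & Z] -> ~~ (Z \subset Q1) ->
  [/\ Q1 \subset Z, ~~ [disjoint Q2 & Z] & ~~ [disjoint Q4 & Z]].
Proof.
move=> cZ AZ dQ1 nZQ; have [sq [q1 q2 q3 q4] part [c1 c2 c3 c4] [e12 e23 e34 e41]] := cs.
have a1Z : a1 \notin Z by apply: AZ; rewrite inE eqxx.
have a1Q : (a1 \in Q1) = false.
  by have := part a1; rewrite inE eqxx; case: (a1 \in Q1).
have sQZ : Q1 \subset Z.
  have XY : Q1 :|: Z != setT.
    by apply/eqP=> /setP/(_ a1); rewrite !inE a1Q (negPf a1Z).
  have [//|h|h] := laminar asym conn c1 cZ XY; first by rewrite h in nZQ.
  by rewrite h in dQ1.
have /= [cZE cQE cZ'E _ _] := cut_corners asym Z Q1.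
rewrite (setIidPr sQZ) in cZE cQE cZ'E.
have D0 : Q1 :\: Z = set0 by apply/eqP; rewrite setD_eq0.
rewrite D0 !(edgesC asym _ set0) !edges0 !addn0 cZ c1 in cZE cQE cZ'E.
have U : Z :|: Q1 = Z by apply/setUidPl.
rewrite U in cZE cQE cZ'E.
have cZ' : 3 <= gcut (Z :\: Q1).
  apply: conn; first by rewrite setD_eq0.
  by apply/eqP=> /setP/(_ a1); rewrite !inE a1Q (negPf a1Z).
have a1e : 0 < gedges [set a1] Q1 by case: sq => _ _ n1 _ _; apply: corner_edge_pos n1 q1.
have le2 Q : gedges Q1 Q = 1 -> (a1 \in Q) = false -> [disjoint Q & Z] -> 1 < gedges Q1 (~: Z).
  move=> eQ a1nQ dQ; apply: leq_trans (_ : gedges Q1 (a1 |: Q) <= _).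
    by rewrite (edgesC asym) edgesU1 ?a1nQ // (edgesC asym Q) eQ addn1 ltnS.
  apply: leq_edges => //; rewrite subUset sub1set inE a1Z /=.
  by rewrite -disjoints_subset.
have e1 : gedges Q1 (~: Z) <= 1.
  have : 0 < gedges Q1 (~: Z).
    apply: leq_trans a1e _; rewrite (edgesC asym); apply: leq_edges => //.
    by rewrite sub1set inE.
  have aux (p q r c : nat) : 3 = 0 + p + q -> 3 = r + q -> c = r + p -> 2 < c -> 0 < q -> q <= 1.
    by clear; lia.
  exact: aux cZE cQE cZ'E cZ'.
have a1Q2 : (a1 \in Q2) = false.
  by have := part a1; rewrite inE eqxx; case: (a1 \in Q1); case: (a1 \in Q2).
have a1Q4 : (a1 \in Q4) = false.
  by have := part a1; rewrite inE eqxx; case: (a1 \in Q4); rewrite ?addn1.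
split=> //; apply: contraL e1; rewrite -ltnNge; apply: le2 => //.
by rewrite (edgesC asym).
Qed.

End CornerCuts.

Section Corners4.
Variables (a1 a2 a3 a4 b1 b2 b3 b4 : G) (Q1 Q2 Q3 Q4 : {set G}).
Hypothesis cs : corners a1 a2 a3 a4 b1 b2 b3 b4 Q1 Q2 Q3 Q4.

(** Otherwise [corner_meets] propagates around the square: [Z] contains all four [Qi], and the four
    edges [ai bi] leave it. *)
Lemma corners_laminar (Z : {set G}) : Z != set0 -> gcut Z = 3 ->
  {in [:: a1; a2; a3; a4], forall a, a \notin Z} ->
  [\/ Z \subset Q1, Z \subset Q2, Z \subset Q3 | Z \subset Q4].
Proof.
move=> Z0 cZ AZ; have cs2 := corners_rot cs; have cs3 := corners_rot cs2.
have cs4 := corners_rot cs3.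
have AZ2 : {in [:: a2; a3; a4; a1], forall a, a \notin Z}.
  by move=> a aA; apply: AZ; rewrite -(mem_rot 1).
have AZ3 : {in [:: a3; a4; a1; a2], forall a, a \notin Z}.
  by move=> a aA; apply: AZ; rewrite -(mem_rot 2).
have AZ4 : {in [:: a4; a1; a2; a3], forall a, a \notin Z}.
  by move=> a aA; apply: AZ; rewrite -(mem_rot 3).
have [|n1] := boolP (Z \subset Q1); first by constructor 1.
have [|n2] := boolP (Z \subset Q2); first by constructor 2.
have [|n3] := boolP (Z \subset Q3); first by constructor 3.
have [|n4] := boolP (Z \subset Q4); first by constructor 4.
have m1 := corner_meets cs cZ AZ; have m2 := corner_meets cs2 cZ AZ2.
have m3 := corner_meets cs3 cZ AZ3; have m4 := corner_meets cs4 cZ AZ4.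
have [sq [q1 q2 q3 q4] part _ _] := cs.
have meets Q z : z \in Z -> z \in Q -> ~~ [disjoint Q & Z].
  by move=> zZ zQ; apply/negP=> /disjointFr/(_ zQ); rewrite zZ.
have [d1 d2 d3 d4] : [/\ ~~ [disjoint Q1 & Z], ~~ [disjoint Q2 & Z],
    ~~ [disjoint Q3 & Z] & ~~ [disjoint Q4 & Z]].
  have [z zZ] := set0Pn _ Z0; have := part z.
  have -> : (z \in [:: a1; a2; a3; a4]) = false.
    by apply/negP=> /AZ; rewrite zZ.
  have [/meets d1 _|_] := boolP (z \in Q1).
    by have [_ d2 d4] := m1 (d1 zZ) n1; have [_ d3 _] := m2 d2 n2; split; rewrite ?d1.
  have [/meets d2 _|_] := boolP (z \in Q2).
    by have [_ d3 d1] := m2 (d2 zZ) n2; have [_ d4 _] := m3 d3 n3; split; rewrite ?d2.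
  have [/meets d3 _|_] := boolP (z \in Q3).
    by have [_ d4 d2] := m3 (d3 zZ) n3; have [_ d1 _] := m4 d4 n4; split; rewrite ?d3.
  have [/meets d4 _|_] := boolP (z \in Q4) => //.
  by have [_ d1 d3] := m4 (d4 zZ) n4; have [_ d2 _] := m1 d1 n1; split; rewrite ?d4.
have [s1 _ _] := m1 d1 n1; have [s2 _ _] := m2 d2 n2.
have [s3 _ _] := m3 d3 n3; have [s4 _ _] := m4 d4 n4.
have [u4 _ k1 k2 [k3 k4]] := sq.
have : gedges (a1 |: (a2 |: (a3 |: [set a4]))) Z <= gcut Z.
  rewrite -(cutC asym) /cut setCK; apply: leq_edges => //.
  by rewrite !subUset !sub1set !inE !AZ // !inE eqxx ?orbT.
move: u4; rewrite /= !inE !negb_or => /and4P[/and3P[a12 a13 a14] /andP[a23 a24] a34 _].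
rewrite !edgesU1 ?inE ?negb_or ?a12 ?a13 ?a14 ?a23 ?a24 ?a34 //.
have := corner_edge_pos k1 (subsetP s1 _ q1); have := corner_edge_pos k2 (subsetP s2 _ q2).
have := corner_edge_pos k3 (subsetP s3 _ q3); have := corner_edge_pos k4 (subsetP s4 _ q4).
rewrite cZ.
have aux (x y z t : nat) : 0 < t -> 0 < z -> 0 < y -> 0 < x -> x + (y + (z + t)) <= 3 -> False.
  by clear; lia.
by move=> p4 p3 p2 p1 /(aux _ _ _ _ p4 p3 p2 p1).
Qed.

End Corners4.
End Corners.

(** * The cube *)

Lemma sum_bool3 (F : bool * bool * bool -> nat) :
  \sum_x F x = \sum_(a : bool) \sum_(b : bool) \sum_(c : bool) F (a, b, c).
Proof. by rewrite pair_bigA pair_bigA; apply: eq_bigr => -[[a b] c]. Qed.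

Lemma cube_cubic : cubic cube.
Proof.
apply/cubic_regular => x; rewrite sum_bool3 !big_bool /=.
by case: x => [[[] []] []].
Qed.

Lemma card_cube : #|cube| = 8.
Proof. by rewrite /= !card_prod card_bool. Qed.

Lemma cube_gconn : gconn cube.
Proof.
move=> X X0 XT.
have -> : gcut X = \sum_x \sum_y ((x \in X) && (y \notin X) && cube_adj x y).
  rewrite /cut /edges big_mkcond; apply: eq_bigr => x _.
  case: (x \in X); last by rewrite big1.
  by rewrite big_mkcond; apply: eq_bigr => y _; rewrite inE; case: (y \in X).
have h0 : ~~ [&& (true, true, true) \notin X, (true, true, false) \notin X,
    (true, false, true) \notin X, (true, false, false) \notin X,
    (false, true, true) \notin X, (false, true, false) \notin X,
    (false, false, true) \notin X & (false, false, false) \notin X].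
  apply: contra X0 => h; apply/eqP/setP=> x; rewrite inE; apply/negbTE.
  by case/and4P: h => ? ? ? /and5P[? ? ? ? ?]; case: x => [[[] []] []].
have h1 : ~~ [&& (true, true, true) \in X, (true, true, false) \in X,
    (true, false, true) \in X, (true, false, false) \in X,
    (false, true, true) \in X, (false, true, false) \in X,
    (false, false, true) \in X & (false, false, false) \in X].
  apply: contra XT => h; apply/eqP/setP=> x; rewrite inE.
  by case/and4P: h => ? ? ? /and5P[? ? ? ? ?]; case: x => [[[] []] []].
move: h0 h1; rewrite sum_bool3 !big_bool !sum_bool3 !big_bool /cube_adj /= !andbT !andbF /=.
(* Only the eight membership bits remain, so the 256 cases are checked by computation. *)
move: ((true, true, true) \in X) ((true, true, false) \in X)
    ((true, false, true) \in X) ((true, false, false) \in X)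
    ((false, true, true) \in X) ((false, true, false) \in X)
    ((false, false, true) \in X) ((false, false, false) \in X).
by clear; do 8!case.
Qed.

Lemma cube_bipartite : bipartite cube.
Proof.
exists (fun x : cube => x.1.1 (+) x.1.2 (+) x.2).
by do 2![case=> [[[] []] []]].
Qed.

(* [cube_axis v w] is the direction of the edge [v w]; the rotation goes through the
   three directions in opposite cyclic orders at even and at odd vertices. *)
Definition cube_axis (v w : cube) : nat :=
  if v.1.1 != w.1.1 then 0 else if v.1.2 != w.1.2 then 1 else 2.

Definition cube_turn (v : cube) (i : nat) : nat :=
  if v.1.1 (+) v.1.2 (+) v.2 then i.+1 %% 3 else i.+2 %% 3.

Definition cube_flip (i : nat) (v : cube) : cube :=
  match i with
  | 0 => (~~ v.1.1, v.1.2, v.2)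
  | 1 => (v.1.1, ~~ v.1.2, v.2)
  | _ => (v.1.1, v.1.2, ~~ v.2)
  end.

Definition cube_next (v w : cube) : cube := cube_flip (cube_turn v (cube_axis v w)) v.

(* The face on the left of the dart [v w] is the side of the cube orthogonal to
   the third direction at [v]. *)
Definition cube_side (v w : cube) : nat * bool :=
  let k := cube_turn v (cube_axis v w) in
  (k, if k == 0 then v.1.1 else if k == 1 then v.1.2 else v.2).

Lemma cube_planar : planar cube.
Proof.
have /fin_all_exists[s0 s0P] : forall d : dart cube, exists d', source d' = source d /\
    source (flip cube d') = cube_next (source d) (source (flip cube d)).
  move=> d.
  have [|d' [h1 h2]] := @dart_exists cube (source d) (cube_next (source d) (source (flip cube d))).
    have := dart_adj d; move: (source d) (source (flip cube d)).
    by do 2![case=> [[[] []] []]].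
  by exists d'.
have s0_inj : injective s0.
  move=> d d' dd'; have [h1 h2] := s0P d; have [h1' h2'] := s0P d'.
  have e : source d = source d' by rewrite -h1 -h1' dd'.
  apply: dart_ext => //; have := dart_adj d; have := dart_adj d'.
  have : cube_next (source d) (source (flip cube d)) = cube_next (source d) (source (flip cube d')).
    by rewrite -h2 dd' h2' e.
  rewrite -e; move: (source d) (source (flip cube d)) (source (flip cube d')).
  by do 3![case=> [[[] []] []]].
pose s := perm s0_inj.
have ss d : source (s d) = source d by rewrite permE; case: (s0P d).
have sn d : s d != d.
  apply/eqP; rewrite permE => e; have [_] := s0P d; rewrite e; have := dart_adj d.
  move: (source d) (source (flip cube d)); by do 2![case=> [[[] []] []]].
have rot := cubic_rotation cube_cubic ss sn.
have c0 : 0 < #|cube| by rewrite card_cube.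
exists s; apply/(plane_embeddingE cube_cubic rot cube_gconn c0).
apply/eqP; rewrite eqn_leq (faces_le cube_cubic rot cube_gconn c0) /= card_cube.
pose sides := [:: (0, true); (0, false); (1, true); (1, false); (2, true); (2, false)].
pose lab d := index (cube_side (source d) (source (flip cube d))) sides.
have lab_lt d : lab d < 6.
  rewrite /lab; have := dart_adj d; move: (source d) (source (flip cube d)).
  by do 2![case=> [[[] []] []]].
pose g d := Ordinal (lab_lt d).
have gf d : g (face_perm s d) = g d.
  apply/val_inj; rewrite /= /lab; have := source_face ss d => ->.
  have -> : source (flip cube (face_perm s d)) = cube_next (source (flip cube d)) (source d).
    have -> : face_perm s d = s0 (flip cube d) by rewrite permM [s _]permE.
    by have [_ ->] := s0P (flip cube d); rewrite flipK.
  have := dart_adj d; move: (source d) (source (flip cube d)).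
  by do 2![case=> [[[] []] []]].
have := card_invariant_porbits gf; rewrite (_ : g @: setT = setT) ?cardsT ?card_ord.
  by apply: (@leq_mul 2 6 2).
apply/setP=> i; rewrite [RHS]inE; apply/imsetP.
suff [v [w vw vwi]] : exists v, exists2 w, cube_adj v w & index (cube_side v w) sides = i.
  have [d [dv dw]] := @dart_exists cube v w vw; exists d => //.
  by apply/val_inj; rewrite /= /lab dv dw vwi.
case: i => [[|[|[|[|[|[|i]]]]]] hi] //=.
- by exists (true, true, true), (true, true, false).
- by exists (false, false, false), (false, true, false).
- by exists (true, true, true), (false, true, true).
- by exists (false, false, false), (false, false, true).
- by exists (true, true, true), (true, false, true).
- by exists (false, false, false), (true, false, false).
Qed.

Lemma cube_C3CBP : C3CBP cube.
Proof.
split; [exact: cube_cubic| |exact: cube_bipartite|exact: cube_planar].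
by apply: cut_three_connected cube_gconn; rewrite ?card_cube //; apply: cube_cubic.
Qed.

Lemma giso_card G H : giso G H -> #|G| = #|H|.
Proof. by case=> g bg _; apply: bij_eq_card bg. Qed.

Lemma giso_sym G H : giso G H -> giso H G.
Proof.
case=> g [h gK hK] gE; exists h; first by exists g.
by move=> x y; rewrite -gE !hK.
Qed.

(** The three neighbours of [x] fill up the three neighbours of [g x], so non-edges are preserved
    too. *)
Lemma cubic_hom_giso (G H : sgraph) (g : H -> G) : cubic G -> cubic H -> injective g ->
  #|G| <= #|H| -> (forall x y, adj x y -> adj (g x) (g y)) -> giso G H.
Proof.
move=> G3 H3 g_inj le_card hom; apply: giso_sym; exists g; first exact: inj_card_bij.
move=> x y; apply/idP/idP => [gxy|]; last exact: hom.
have E : g @: [set z | adj x z] = [set z | adj (g x) z].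
  apply/eqP; rewrite eqEcard card_imset // G3 H3 leqnn andbT.
  by apply/subsetP=> _ /imsetP[z xz ->]; rewrite !inE in xz *; apply: hom.
have : g y \in g @: [set z | adj x z] by rewrite E inE.
by rewrite mem_imset // inE.
Qed.

(** * Single-vertex corners: the cube and reduction R4 *)

Section Corners.
Variable G : sgraph.
Hypotheses (G3 : cubic G) (conn : gconn G).
Let asym := @adjn_sym G.

Lemma edges11 (x y : G) : gedges [set x] [set y] = adj x y :> nat.
Proof. by rewrite edges1 big_set1. Qed.

Section Trivial.
Variables (a1 a2 a3 a4 b1 b2 b3 b4 : G) (Q1 Q2 Q3 Q4 : {set G}).
Hypothesis cs : corners a1 a2 a3 a4 b1 b2 b3 b4 Q1 Q2 Q3 Q4.

Lemma corner_adj : Q1 = [set b1] -> Q2 = [set b2] -> adj b1 b2.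
Proof.
move=> E1 E2; have [_ _ _ _ [+ _ _ _]] := cs.
by rewrite E1 E2 edges11; case: (adj b1 b2).
Qed.

Lemma corners_uniq : uniq [:: a1; a2; a3; a4; b1; b2; b3; b4].
Proof.
have [[u4 nb _ _ _] [q1 q2 q3 q4] part _ _] := cs.
rewrite -[[:: _, _, _, _ & _]]/([:: a1; a2; a3; a4] ++ [:: b1; b2; b3; b4]) cat_uniq u4.
have -> : has (mem [:: a1; a2; a3; a4]) [:: b1; b2; b3; b4] = false.
  by apply/negbTE; rewrite -all_predC.
have nb' b b' (Q Q' : {set G}) : b \in Q -> b' \in Q' -> (b \in Q') = false -> b != b'.
  by move=> bQ b'Q' h; apply: contraFneq h => ->.
rewrite /= !inE !negb_or.
have p1 := part b1; have p2 := part b2; have p3 := part b3.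
rewrite q1 in p1; rewrite q2 in p2; rewrite q3 in p3.
have [h12 h13 h14] : [/\ (b1 \in Q2) = false, (b1 \in Q3) = false & (b1 \in Q4) = false].
  move: p1; case: (_ \in [:: _; _; _; _]); case: (b1 \in Q2); case: (b1 \in Q3);
  by case: (b1 \in Q4).
have [h23 h24] : (b2 \in Q3) = false /\ (b2 \in Q4) = false.
  move: p2; case: (_ \in [:: _; _; _; _]); case: (b2 \in Q1); case: (b2 \in Q3);
  by case: (b2 \in Q4).
have h34 : (b3 \in Q4) = false.
  move: p3; case: (_ \in [:: _; _; _; _]); case: (b3 \in Q1); case: (b3 \in Q2);
  by case: (b3 \in Q4).
rewrite (nb' _ _ _ _ q1 q2 h12) (nb' _ _ _ _ q1 q3 h13) (nb' _ _ _ _ q1 q4 h14).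
by rewrite (nb' _ _ _ _ q2 q3 h23) (nb' _ _ _ _ q2 q4 h24) (nb' _ _ _ _ q3 q4 h34).
Qed.

End Trivial.

Section Cases.
Variables (a1 a2 a3 a4 b1 b2 b3 b4 : G) (Q1 Q2 Q3 Q4 : {set G}).
Hypothesis cs : corners a1 a2 a3 a4 b1 b2 b3 b4 Q1 Q2 Q3 Q4.
Hypotheses (E1 : Q1 = [set b1]) (E2 : Q2 = [set b2]) (E3 : Q3 = [set b3]).

Let cs2 := corners_rot cs.
Let cs3 := corners_rot cs2.
Let cs4 := corners_rot cs3.
Let b12 : adj b1 b2 := corner_adj cs E1 E2.
Let b23 : adj b2 b3 := corner_adj cs2 E2 E3.

Lemma corners_cube : Q4 = [set b4] -> giso G cube.
Proof.
move=> E4; have b34 := corner_adj cs3 E3 E4; have b41 := corner_adj cs4 E4 E1.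
have [[u4 nb n1 n2 [n3 n4]] _ part _ _] := cs.
have [a12 a14 ab1] : [/\ adj a1 a2, adj a1 a4 & adj a1 b1] by rewrite !n1.2 !inE !eqxx !orbT.
have [a23 ab2] : adj a2 a3 /\ adj a2 b2 by rewrite !n2.2 !inE !eqxx !orbT.
have [a34 ab3] : adj a3 a4 /\ adj a3 b3 by rewrite !n3.2 !inE !eqxx !orbT.
have ab4 : adj a4 b4 by rewrite !n4.2 !inE !eqxx !orbT.
(* The first two bits go around a 4-cycle; the third tells the [ai] from the [bi]. *)
pose ix (x : cube) : nat := match x with
  | (false, false, z) => if z then 4 else 0
  | (true, false, z) => if z then 5 else 1
  | (true, true, z) => if z then 6 else 2
  | (false, true, z) => if z then 7 else 3
  end.
have ix_inj : injective ix by do 2![case=> [[[] []] []]].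
have ix_lt x : ix x < 8 by case: x => [[[] []] []].
pose L := [:: a1; a2; a3; a4; b1; b2; b3; b4].
apply: (@cubic_hom_giso _ _ (fun x => nth a1 L (ix x))) => //; first exact: cube_cubic.
- move=> x y /eqP; rewrite nth_uniq ?ix_lt //; first by move/eqP/ix_inj.
  exact: corners_uniq cs.
- rewrite card_cube -(_ : size L = 8) // -cardsT -(card_uniqP (corners_uniq cs)).
  apply/subset_leq_card/subsetP=> v _; have := part v.
  rewrite E1 E2 E3 E4 !inE.
  by do 8![case: (_ == _) => //=].
- do 2![case=> [[[] []] []]] => //= _; by rewrite // adj_sym.
Qed.

Variable s : {perm dart G}.
Hypotheses (G0 : 0 < #|G|) (bip : bipartite G).
Hypotheses (rot : rotation_system s) (faces : 2 * #|porbits (face_perm s)| = #|G| + 4).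

Lemma corners_R4 : 1 < #|Q4| -> exists H, C3CBP H /\ R4 G H.
Proof.
move=> Q41.
have [[u4 nb n1 n2 [n3 n4]] [q1 q2 q3 q4] part [_ _ _ c4] [_ _ e34 e41]] := cs.
have [y2 y2Q b1y2] : exists2 y, y \in Q4 & adj b1 y.
  move: e41; rewrite E1 (edgesC asym) edges1 => e.
  have : [exists y in Q4, adj b1 y].
    by apply: contra_eqT e => /exists_inPn no; rewrite big1 // => y /no/negPf->.
  by case/exists_inP=> y; exists y.
have [y3 y3Q b3y3] : exists2 y, y \in Q4 & adj b3 y.
  move: e34; rewrite E3 edges1 => e.
  have : [exists y in Q4, adj b3 y].
    by apply: contra_eqT e => /exists_inPn no; rewrite big1 // => y /no/negPf->.
  by case/exists_inP=> y; exists y.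
(* In the order [j], [h1], [h2], [h3], [x1], [x2], [x3] of R4: [a2] is opposite to the corner [Q4],
   which plays the missing vertex of the cube. *)
pose L := [:: a2; a1; a3; b2; a4; b1; b3].
have memL v : (v \in L) = (v \notin Q4).
  have := part v; rewrite E1 E2 E3 !inE.
  by do 7?[case: (v == _) => //=]; case: (v \in Q4).
have uL : uniq L.
  have := corners_uniq cs; rewrite -[[:: _, _, _, _ & _]]/(rcons [:: a1; a2; a3; a4; b1; b2; b3] b4).
  rewrite rcons_uniq => /andP[_]; congr is_true; apply: perm_uniq.
  by apply/seq.permP=> p; rewrite /=; clear; lia.
have nb1 : nbrs b1 a1 b2 y2.
  apply: nbrs_cubic => //; last by rewrite adj_sym n1.2 !inE eqxx !orbT.
  have := uL; rewrite /= !inE !negb_or => /and5P[_ /and5P[_ -> _ _ _] _ _ _].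
  by rewrite !(contraTneq _ y2Q) // => <-; rewrite -memL !inE eqxx ?orbT.
have nb2 : nbrs b2 a2 b1 b3.
  apply: nbrs_cubic => //.
  - exact: (mask_uniq uL [:: true; false; false; false; false; true; true]).
  - by rewrite adj_sym n2.2 !inE eqxx !orbT.
  - by rewrite adj_sym.
have nb3 : nbrs b3 a3 b2 y3.
  apply: nbrs_cubic => //.
  - rewrite -[[:: a3; b2; y3]]/(rcons [:: a3; b2] y3) rcons_uniq.
    rewrite (mask_uniq uL [:: false; false; true; true]) andbT; apply: contraL y3Q => h.
    by rewrite -memL; apply: (@mem_mask _ _ [:: false; false; true; true]).
  - by rewrite adj_sym n3.2 !inE eqxx !orbT.
  - by rewrite adj_sym.
pose Z := [set z in L].
have ZQ : Z = ~: Q4 by apply/setP=> v; rewrite !in_set memL.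
have cZ : gcut Z = 3 by rewrite ZQ (cutC asym).
have Z1 : 1 < #|~: Z| by rewrite ZQ setCK.
have inQ v : v \in Q4 -> v \notin Z by rewrite in_set memL negbK.
pose Y1 : del_vertices Z := exist (fun x => x \notin Z) b4 (inQ _ q4).
pose Y2 : del_vertices Z := exist (fun x => x \notin Z) y2 (inQ _ y2Q).
pose Y3 : del_vertices Z := exist (fun x => x \notin Z) y3 (inQ _ y3Q).
have out z y : z \in L -> y \in Q4 -> adj z y ->
    [\/ z = a4 /\ y = b4, z = b1 /\ y = y2 | z = b3 /\ y = y3].
  move=> zL yQ; have : y \notin L by rewrite memL negbK.
  rewrite !inE !negb_or => /and5P[/negPf y_1 /negPf y_2 /negPf y_3 /negPf y_4].
  case/and3P=> /negPf y_5 /negPf y_6 /negPf y_7.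
  move: zL; rewrite !inE; do 6?[case/predU1P=> [->|]]; last move/eqP->;
    rewrite ?(n1.2, n2.2, n3.2, n4.2, nb1.2, nb2.2, nb3.2) !inE
      ?(y_1, y_2, y_3, y_4, y_5, y_6, y_7) //= => /eqP->.
  - by constructor 1.
  - by constructor 2.
  - by constructor 3.
have bdE : boundary Z = [set Y1; Y2; Y3].
  have inL : [/\ a4 \in Z, b1 \in Z & b3 \in Z] by rewrite !inE !eqxx !orbT.
  have [a4Z b1Z b3Z] := inL.
  apply/setP=> v; rewrite inE; apply/exists_inP/idP=> [[z zZ vz]|].
    have vQ : val v \in Q4 by have := valP v; rewrite in_set memL negbK.
    have zL : z \in L by rewrite inE in zZ.
    rewrite adj_sym in vz; rewrite !inE -!val_eqE /=.
    by have [[_ e]|[_ e]|[_ e]] := out _ _ zL vQ vz; rewrite e eqxx ?orbT.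
  rewrite !inE -orbA => /or3P[]/eqP->.
  - by exists a4; rewrite // adj_sym n4.2 !inE eqxx !orbT.
  - by exists b1; rewrite // adj_sym.
  - by exists b3; rewrite // adj_sym.
exists (contraction Z); split.
  have H3 := contraction_cubic G3 conn cZ Z1.
  have Hc := contraction_gconn G3 conn cZ Z1.
  split=> //.
  - by apply: cut_three_connected => //; rewrite card_contraction addn1.
  - have [c cG] := bip; apply: (contraction_bipartite (c := c) (b := c b4)) => // x z xZ zZ xz.
    have zL : z \in L by rewrite inE in zZ.
    have xQ : x \in Q4 by move: xZ; rewrite in_set memL negbK.
    have h1 : c a4 != c b4 by apply: cG; rewrite n4.2 !inE eqxx !orbT.
    have h2 : c a4 != c a1 by apply: cG; rewrite n4.2 !inE eqxx.
    have h3 : c a4 != c a3 by apply: cG; rewrite n4.2 !inE eqxx !orbT.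
    have h4 : c a1 != c b1 by apply: cG; rewrite n1.2 !inE eqxx !orbT.
    have h5 : c a3 != c b3 by apply: cG; rewrite n3.2 !inE eqxx !orbT.
    rewrite adj_sym in xz; have := cG _ _ xz.
    have [[-> ->]|[-> _]|[-> _]] := out _ _ zL xQ xz => //; move: h1 h2 h3 h4 h5;
      by case: (c a4); case: (c a1); case: (c a3); case: (c b1); case: (c b3); case: (c b4); case: (c x).
  - exact: (contraction_planar G3 conn G0 rot faces cZ Z1).
exists a2, a1, a3, b2, a4, b1, b3; exists Y1, Y2, Y3; split=> //.
- have E m n : m < 7 -> n < 7 -> (nth a2 L n == nth a2 L m) = (n == m).
    by move=> m7 n7; rewrite nth_uniq.
  have Ey n y : n < 7 -> y \in Q4 -> (nth a2 L n == y) = false.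
    by move=> n7; apply: contraTF => /eqP<-; rewrite -memL mem_nth.
  have T m p q r n : nbrs (nth a2 L m) (nth a2 L p) (nth a2 L q) (nth a2 L r) ->
      p < 7 -> q < 7 -> r < 7 -> n < 7 ->
      adj (nth a2 L m) (nth a2 L n) = [|| n == p, n == q | n == r].
    by move=> [_ nb'] p7 q7 r7 n7; rewrite nb' !inE !E.
  have Ty m p q y n : nbrs (nth a2 L m) (nth a2 L p) (nth a2 L q) y -> y \in Q4 ->
      p < 7 -> q < 7 -> n < 7 -> adj (nth a2 L m) (nth a2 L n) = (n == p) || (n == q).
    by move=> [_ nb'] yQ p7 q7 n7; rewrite nb' !inE !E // Ey // orbF.
  case=> [|[|[|[|[|[|[|//]]]]]]] n _ n7.
  - rewrite (@T 0 2 1 3) //; move: n n7; do 7?[case=> //].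
  - rewrite (@T 1 0 4 5) //; move: n n7; do 7?[case=> //].
  - rewrite (@T 2 4 0 6) //; move: n n7; do 7?[case=> //].
  - rewrite (@T 3 0 5 6) //; move: n n7; do 7?[case=> //].
  - rewrite (@Ty 4 1 2 b4) //; move: n n7; do 7?[case=> //].
  - rewrite (@Ty 5 1 3 y2) //; move: n n7; do 7?[case=> //].
  - rewrite (@Ty 6 2 3 y3) //; move: n n7; do 7?[case=> //].
- by split => //; rewrite n4.2 !inE eqxx !orbT.
- by rewrite /contraction bdE; apply: giso_refl.
Qed.

End Cases.
End Corners.

(** * Existence of a reduction *)

Lemma face4_square (G : sgraph) (s : {perm dart G}) O : cubic G -> rotation_system s ->
  O \in porbits (face_perm s) -> #|O| = 4 ->
  exists d1 d2 d3 d4, face_square s d1 d2 d3 d4 /\ [/\ d1 \in O, d2 \in O, d3 \in O & d4 \in O].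
Proof.
move=> G3 rot /imsetP[d _ ->] O4; set f := face_perm s.
have f4 : f (f (f (f d))) = d by have := iter_porbit f d; rewrite O4.
have sf e : source (f e) = source (flip G e) := source_face (source_rot rot) e.
have s1 e : source (f e) != source e.
  by rewrite sf; apply/eqP=> h; have := dart_adj e; rewrite h adj_irr.
(* Returning after two steps would mean [f e = flip e], a dart fixed by [s]. *)
have s2 e : source (f (f e)) != source e.
  apply/eqP=> h; have fe : f e = flip G e.
    by apply: dart_ext; rewrite ?sf // -sf h flipK.
  by have /eqP := fe; rewrite permM (negPf (rot_neq G3 rot _).1).
exists d, (f d), (f (f d)), (f (f (f d))); split; last first.
  by rewrite !porbit_step porbit_id.
have s1' e : source e != source (f e) by rewrite eq_sym.
have s2' e : source e != source (f (f e)) by rewrite eq_sym.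
have s3 : source d != source (f (f (f d))) by rewrite -{1}f4 s1.
by split=> //; rewrite /= !inE !negb_or !s1' !s2' s3.
Qed.

Lemma reduction_exists (G : sgraph) : C3CBP G ->
  giso G cube \/ exists H, C3CBP H /\ (R0 G H \/ R4 G H).
Proof.
case=> G3 C3 bip [s emb]; have conn := three_connected_cut G3 C3.
have G0 : 0 < #|G| by case: C3 => h _; apply: leq_trans h.
have rot : rotation_system s by case: emb.
have faces := proj1 (plane_embeddingE G3 rot conn G0) emb.
pose cand (X : {set G}) := [&& gcut X == 3, 1 < #|X| & 1 < #|~: X|].
(* Without a candidate, [X] is [setT] and minimality is vacuous, so both situations share the
   argument below. *)
have [X [O [Of O4 OX] minX]] : exists X : {set G}, exists2 O : {set dart G},
    [/\ O \in porbits (face_perm s), #|O| = 4 & O \subset from X] &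
    (forall Q : {set G}, cand Q -> Q \subset X -> Q = X) /\
    (cand X \/ X = setT /\ forall Q, ~~ cand Q).
  have [/existsP[X1 cX1]|no] := boolP [exists X, cand X].
    case: (arg_minnP (fun X : {set G} => #|X|) cX1) => X cX minX.
    have /and3P[/eqP cX3 X2 _] := cX.
    have [O OX O4] := four_face G3 conn G0 rot faces cX3 bip X2.
    exists X, O; first by move: OX; rewrite inE => /andP[].
    split; last by left.
    by move=> Q cQ sQX; apply/eqP; rewrite eqEcard sQX minX.
  have [O Of O4] := four_face_all G3 G0 rot faces bip.
  exists setT, O; first by split=> //; apply/subsetP=> d; rewrite !inE.
  have no' Q : ~~ cand Q by move: no; rewrite negb_exists => /forallP.
  by split; [move=> Q; rewrite (negPf (no' Q))|right].
have [d1 [d2 [d3 [d4 [fs [o1 o2 o3 o4]]]]]] := face4_square G3 rot Of O4.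
have sq := face_square_square G3 bip rot fs.
pose bad e1 e2 e3 e4 := [exists X : {set G}, [&& gcut X <= 4,
  all (mem X) [:: source e1; source e2; third s e1; third s e2] &
  all [predC X] [:: source e3; source e4; third s e3; third s e4]]].
have R0_or e1 e2 e3 e4 : face_square s e1 e2 e3 e4 -> ~~ bad e1 e2 e3 e4 ->
    exists H, C3CBP H /\ (R0 G H \/ R4 G H).
  move=> fs'; rewrite negb_exists => /forallP nb.
  have [|H [cH rH]] := R0_reduction G3 conn G0 bip rot faces fs'.
    move=> Y [y1 y2 y3 y4] [y5 y6 y7 y8]; rewrite ltnNge; apply: contra (nb Y) => ->.
    by rewrite /= y1 y2 y3 y4 y5 y6 y7 y8.
  by exists H; split=> //; left.
have [/existsP[Y1 /and3P[cY1 yin1 yout1]]|nb] := boolP (bad d1 d2 d3 d4); last first.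
  by right; apply: R0_or nb.
have [/existsP[Y2 /and3P[cY2 yin2 yout2]]|nb] := boolP (bad d2 d3 d4 d1); last first.
  by right; apply: R0_or nb; apply: face_square_rot.
have [Q1 [Q2 [Q3 [Q4 cs]]]] : exists Q1 Q2 Q3 Q4 : {set G},
    corners (source d1) (source d2) (source d3) (source d4)
      (third s d1) (third s d2) (third s d3) (third s d4) Q1 Q2 Q3 Q4.
  move: yin1 yout1 yin2 yout2 => /=.
  case/and5P=> p1 p2 p3 p4 _ /and5P[p5 p6 p7 p8 _] /and5P[r1 r2 r3 r4 _] /and5P[r5 r6 r7 r8 _].
  by apply: (cut_corners_exist G3 conn (X := Y1) (Y := Y2)).
have cs2 := corners_rot cs; have cs3 := corners_rot cs2; have cs4 := corners_rot cs3.
(* With two vertices, [Q1'] would be a candidate, since [a1] and [a2] lie outside; minimality gives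
   [Q1' = X], but [a1] is only in [X]. *)
have small Q1' Q2' Q3' Q4' a1 a2 a3 a4 b1 b2 b3 b4 :
    corners a1 a2 a3 a4 b1 b2 b3 b4 Q1' Q2' Q3' Q4' -> a1 \in X -> Q1' \subset X -> Q1' = [set b1].
  move=> [[u4 _ _ _ _] [b1Q _ _ _] part [cQ _ _ _] _] a1X sQX; apply: corner_triv => //.
  have nQ a : a \in [:: a1; a2; a3; a4] -> a \notin Q1'.
    by move=> aA; have := part a; rewrite aA; case: (a \in Q1').
  have a1Q : a1 \notin Q1' by apply: nQ; rewrite inE eqxx.
  rewrite leqNgt; apply: contra a1Q => Q1gt.
  suff -> : Q1' = X by [].
  apply: minX.1 => //; rewrite /cand cQ Q1gt /=.
  have s2 : [set a1; a2] \subset ~: Q1'.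
    by apply/subsetP=> a; rewrite !inE => /orP[]/eqP->; apply: nQ; rewrite !inE eqxx ?orbT.
  apply: leq_trans (subset_leq_card s2).
  by rewrite cards2; move: u4; rewrite /= !inE !negb_or -andbA => /and3P[->].
have [x1 x2 x3 x4] : [/\ source d1 \in X, source d2 \in X, source d3 \in X & source d4 \in X].
  by split; [have := subsetP OX _ o1|have := subsetP OX _ o2
            |have := subsetP OX _ o3|have := subsetP OX _ o4]; rewrite inE.
have [cX|[XT no]] := minX.2; last first.
  left; apply: (corners_cube G3 cs); [apply: small cs _ _|apply: small cs2 _ _
    |apply: small cs3 _ _|apply: small cs4 _ _]; by rewrite // XT subsetT.
(* After a rotation [~: X] lies in the fourth corner, so the other three lie in [X] and are single
   vertices. *)
have final Q1' Q2' Q3' Q4' a1 a2 a3 a4 b1 b2 b3 b4 :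
    corners a1 a2 a3 a4 b1 b2 b3 b4 Q1' Q2' Q3' Q4' -> a1 \in X -> a2 \in X -> a3 \in X ->
    ~: X \subset Q4' -> exists H, C3CBP H /\ (R0 G H \/ R4 G H).
  move=> c1 h1 h2 h3 sZ; have c2 := corners_rot c1; have c3 := corners_rot c2.
  have sub (Q : {set G}) : (forall v, v \in Q -> v \notin Q4') -> Q \subset X.
    by move=> dQ; apply/subsetP=> v /dQ; apply: contraR => vX; apply: (subsetP sZ); rewrite inE.
  have [_ _ part _ _] := c1.
  have E1 : Q1' = [set b1].
    apply: small c1 _ _ => //; apply: sub => v vQ; have := part v; rewrite vQ.
    by case: (v \in Q4') => //; rewrite !addn1.
  have E2 : Q2' = [set b2].
    apply: small c2 _ _ => //; apply: sub => v vQ; have := part v; rewrite vQ.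
    by case: (v \in Q4') => //; rewrite !addn1 addSn.
  have E3 : Q3' = [set b3].
    apply: small c3 _ _ => //; apply: sub => v vQ; have := part v; rewrite vQ.
    by case: (v \in Q4') => //; rewrite !addn1.
  have [|H [cH rH]] := corners_R4 G3 conn c1 E1 E2 E3 G0 bip rot faces.
    by apply: leq_trans (subset_leq_card sZ); case/and3P: cX.
  by exists H; split=> //; right.
right; have Z0 : ~: X != set0.
  by rewrite -card_gt0; case/and3P: cX => _ _; apply: leq_trans.
have cZ : gcut (~: X) = 3 by rewrite (cutC (@adjn_sym G)); case/and3P: cX => /eqP.
have AZ : {in [:: source d1; source d2; source d3; source d4], forall a, a \notin ~: X}.
  by move=> a; rewrite !inE negbK => /or4P[]/eqP->.
have [sZ|sZ|sZ|sZ] := corners_laminar conn cs Z0 cZ AZ.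
- exact: final cs2 _ _ _ sZ.
- exact: final cs3 _ _ _ sZ.
- exact: final cs4 _ _ _ sZ.
- exact: final cs _ _ _ sZ.
Qed.

(** * Termination and conclusion *)

Lemma card_del_vertices (G : sgraph) (S : {set G}) : #|del_vertices S| + #|S| = #|G|.
Proof.
rewrite -(cardsC S) addnC /= card_sig; congr (_ + _).
by apply: eq_card => v; rewrite !inE.
Qed.

Lemma reduction_card (G H : sgraph) : R0 G H \/ R4 G H -> #|H| < #|G|.
Proof.
case=> [[a1 [a2 [a3 [a4 [b1 [b2 [b3 [b4 [_ _ _ iso]]]]]]]]]|].
  have -> : #|H| = #|del_vertices [set a1; a2; a3; a4]| by case: iso => /giso_card.
  rewrite -(card_del_vertices [set a1; a2; a3; a4]) -[X in X < _]addn0 ltn_add2l card_gt0.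
  by apply/set0Pn; exists a1; rewrite !inE eqxx.
case=> [j [h1 [h2 [h3 [x1 [x2 [x3 [y1 [y2 [y3 [u _ _ /giso_card <-]]]]]]]]]]].
rewrite [X in X < _]card_option -addn1.
rewrite -(card_del_vertices [set z in [:: j; h1; h2; h3; x1; x2; x3]]).
by rewrite -addn1 -addnA leq_add2l cardsE (card_uniqP u).
Qed.

Lemma reduces_exists G : C3CBP G -> giso G cube \/ exists H, reduces G H.
Proof.
by move=> GB; case: (reduction_exists GB) => [|[H [HB r]]]; [left|right; exists H].
Qed.

Theorem corollary8p9 :
  [/\ C3CBP cube,
      forall G : sgraph, C3CBP G -> #|G| <= 8 -> giso G cube,
      forall G : sgraph, C3CBP G -> ~ giso G cube -> leads_to_cube G
    & forall G : sgraph, C3CBP G -> generated_from_cube G].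
Proof.
split; first exact: cube_C3CBP.
(* Otherwise a reduction would give a C3CBP with fewer than 8 vertices, against [card_ge8]. *)
- move=> G GB G8; have [//|[H [_ HB r]]] := reduces_exists GB.
  have [H3 C3 bip [s emb]] := HB.
  have H0 : 0 < #|H| by case: C3 => h _; apply: leq_trans h.
  have rot : rotation_system s by case: emb.
  have conn := three_connected_cut H3 C3.
  have faces := proj1 (plane_embeddingE H3 rot conn H0) emb.
  have := leq_trans (leq_trans (reduction_card r) G8) (card_ge8 H3 H0 rot faces bip).
  by rewrite ltnn.
- suff leads n (G : sgraph) : #|G| < n -> C3CBP G -> leads_to_cube G.
    by move=> G GB _; apply: leads (ltnSn _) GB.
  elim: n G => // n IHn G ltGn GB; have [iso|ex] := reduces_exists GB; first exact: leads_now.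
  apply: leads_step => // H [_ HB r]; apply: IHn HB.
  exact: leq_trans (reduction_card r) ltGn.
- move=> G; have [n] := ubnP #|G|; elim: n G => // n IHn G ltGn GB.
  have [iso|[H GH]] := reduces_exists GB; first by apply: generated_cube; apply: giso_sym.
  have [_ HB r] := GH; apply: generated_step GH; apply: IHn HB.
  exact: leq_trans (reduction_card r) ltGn.
Qed.
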